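(* Let $u\colon\mathbb N\to\mathbb C$ be a bounded arithmetic function. Then $u\perp\mathscr C_{\rm ID}$ if and only if for each $\varepsilon>0$ and each increasing sequence $(N_k)$ defining a Furstenberg system of $u$ there exists $H_0\ge1$ such that for each $H\ge H_0$, $$\lim_{k\to\infty}\frac1{N_k}\sum_{n\le N_k}\left|\frac1H\sum_{h\le H}u(n+h)\right|^2\le\varepsilon .$$
   Context: A topological dynamical system $(X,T)$ is a homeomorphism $T$ of a compact metric space $X$. A $T$-invariant Borel probability measure $\nu$ on $X$ is visible if there are $x\in X$ and an increasing sequence $(N_\ell)$ of integers with $\frac1{N_\ell}\sum_{n\le N_\ell}\delta_{T^nx}\to\nu$ weak-$*$. $\mathscr C_{\rm ID}$ is the class of topological systems $(X,T)$ such that for each visible measure $\nu$ the system $(X,\mathcal B(X),\nu,T)$ is (isomorphic to) an identity transformation of a standard Borel probability space. $u\perp\mathscr C_{\rm ID}$ means that $\lim_{N\to\infty}\frac1N\sum_{n\le N}f(T^nx)u(n)=0$ for all $(X,T)\in\mathscr C_{\rm ID}$, $f\in C(X)$ and $x\in X$. Let $|u|\le L$. Extend $u$ to $\mathbb Z$ by $u(-n)=u(n)$ for $n\in\mathbb N$ and any $u(0)$ with $|u(0)|\le L$. Let $S$ be the left shift on $\{z\in\mathbb C:|z|\le L\}^{\mathbb Z}$. An increasing sequence $(N_k)$ of positive integers defines a Furstenberg system of $u$ if the measures $\frac1{N_k}\sum_{n\le N_k}\delta_{S^nu}$ converge in the weak-$*$ topology. *)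

(* Defs.v *)
From HB Require Import structures.
From mathcomp Require Import all_boot all_order all_algebra.
From mathcomp Require Import all_classical all_reals all_analysis.
From mathcomp Require Import complex.

Set Implicit Arguments.
Unset Strict Implicit.
Unset Printing Implicit Defensive.

Import Order.TTheory GRing.Theory Num.Theory numFieldNormedType.Exports.

Local Open Scope classical_set_scope.
Local Open Scope ring_scope.
Local Open Scope complex_scope.

(* The complex numbers carry the topology of the norm [`|_|]; this is the
   library's topology on [F^o] for a numFieldType [F]. *)
HB.instance Definition _ (R : realType) := GRing.ComAlgebra.copy R[i] R[i]^o.
HB.instance Definition _ (R : realType) := Vector.copy R[i] R[i]^o.
HB.instance Definition _ (R : realType) := NormedModule.copy R[i] R[i]^o.

(* Measurable types are pointed in the library, so metric spaces are given a
   base point; this only excludes the empty space. *)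
#[short(type="pmetricType")]
HB.structure Definition PointedMetric (K : numDomainType) :=
  {M of Metric K M & isPointed M}.

Notation borel X := (g_sigma_algebraType (@open X)).

Definition mean_upto (F : fieldType) (a : nat -> F) (N : nat) : F :=
  N%:R^-1 * \sum_(1 <= n < N.+1) a n.

Definition increasing_positive (N : nat -> nat) : Prop :=
  (0 < N 0)%N /\ {homo N : k l / (k < l)%N >-> (k < l)%N}.

Section dynamics.
Context {R : realType}.

Definition homeomorphism (X : topologicalType) (T : X -> X) : Prop :=
  continuous T /\
  exists S : X -> X, [/\ continuous S, cancel T S & cancel S T].

Definition topological_system (X : pmetricType R) (T : X -> X) : Prop :=
  compact [set: X] /\ homeomorphism T.

(* (1 / N) * (dirac (T x) + ... + dirac (T^N x)); [msum m N] is the sum of the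
   [m k] for [k < N]. *)
Definition empirical (X : ptopologicalType) (T : X -> X) (x : X) (N : nat) :
    {measure set (borel X) -> \bar R} :=
  mscale (N%:R^-1)%:nng (msum (fun k => dirac (iter k.+1 T x : borel X)) N).

(* Complex test functions give the same notion, by linearity. *)
Definition weak_star_cvg (X : ptopologicalType)
    (mu : nat -> {measure set (borel X) -> \bar R})
    (nu : {measure set (borel X) -> \bar R}) : Prop :=
  forall f : X -> R, continuous f ->
    (\int[mu k]_x (f x)%:E)%E @[k --> \oo] --> (\int[nu]_x (f x)%:E)%E.

Definition invariant_measure d (X : measurableType d) (T : X -> X)
    (nu : probability X R) : Prop :=
  forall A, measurable A -> nu (T @^-1` A) = nu A.

Definition visible (X : pmetricType R) (T : X -> X)
    (nu : probability (borel X) R) : Prop :=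
  invariant_measure (T : borel X -> borel X) nu /\
  exists (x : X) (N : nat -> nat),
    increasing_positive N /\ weak_star_cvg (fun l => empirical T x (N l)) nu.

Definition polish (P : pmetricType R) : Prop :=
  (forall F : set_system P, ProperFilter F -> cauchy F -> cvg F) /\
  exists2 D : set P, countable D & dense D.

Definition standard_borel d (Y : measurableType d) : Prop :=
  exists (P : pmetricType R) (g : Y -> borel P) (h : borel P -> Y),
    [/\ polish P, measurable_fun [set: Y] g,
        measurable_fun [set: borel P] h, cancel g h & cancel h g].

(* Isomorphism modulo null sets: [phi] restricts to a bimeasurable bijection
   between the invariant sets [X0] and [Y0] of full measure. *)
Definition isomorphic d (X : measurableType d) (mu : probability X R)
    (T : X -> X) d' (Y : measurableType d') (nu : probability Y R)
    (S : Y -> Y) : Prop :=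
  exists (X0 : set X) (Y0 : set Y) (phi : X -> Y),
    [/\ [/\ measurable X0, mu X0 = 1%E & T @` X0 `<=` X0],
        [/\ measurable Y0, nu Y0 = 1%E & S @` Y0 `<=` Y0],
        [/\ set_bij X0 Y0 phi, measurable_fun X0 phi
          & forall A, measurable A -> A `<=` X0 -> measurable (phi @` A)],
        forall B, measurable B -> mu (X0 `&` phi @^-1` B) = nu B
      & forall x, X0 x -> phi (T x) = S (phi x)].

Definition class_ID (X : pmetricType R) (T : X -> X) : Prop :=
  topological_system T /\
  forall nu : probability (borel X) R, visible T nu ->
    exists (d : measure_display) (Y : measurableType d)
           (kappa : probability Y R),
      standard_borel Y /\ isomorphic nu (T : borel X -> borel X) kappa id.

(* Only the values [u n] for [n >= 1] are used. *)
Definition orthogonal_class_ID (u : nat -> R[i]) : Prop :=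
  forall (X : pmetricType R) (T : X -> X), class_ID T ->
  forall (f : X -> R[i]) (x : X), continuous f ->
    mean_upto (fun n => f (iter n T x) * u n) N @[N --> \oo] --> (0 : R[i]).

End dynamics.

Section furstenberg.
Context {R : realType}.

Definition closed_disc (L : {nonneg R}) : Type :=
  set_type [set z : R[i] | `|z| <= (L%:num)%:C].

HB.instance Definition _ L := Topological.on (closed_disc L).

Lemma closed_disc_subproof (L : {nonneg R}) (z : R[i]) :
  `|z| <= (L%:num)%:C -> z \in [set z : R[i] | `|z| <= (L%:num)%:C].
Proof. by move=> zL; rewrite inE. Qed.

Definition to_closed_disc (L : {nonneg R}) (z : R[i])
    (zL : `|z| <= (L%:num)%:C) : closed_disc L :=
  exist _ z (closed_disc_subproof zL).

Lemma closed_disc0_subproof (L : {nonneg R}) : `|0 : R[i]| <= (L%:num)%:C.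
Proof. by rewrite normr0 lecR. Qed.

HB.instance Definition _ L :=
  isPointed.Build (closed_disc L) (to_closed_disc (closed_disc0_subproof L)).

Definition shift_space (L : {nonneg R}) : Type := int -> closed_disc L.

HB.instance Definition _ L :=
  Topological.copy (shift_space L)
    (prod_topology (fun _ : int => closed_disc L)).

HB.instance Definition _ L :=
  isPointed.Build (shift_space L) (fun _ => point).

Definition left_shift (L : {nonneg R}) (z : shift_space L) : shift_space L :=
  fun m => z (m + 1).

(* [u] is indexed by the positive integers, so the value [u 0%N] is ignored and
   replaced by [u0]. *)
Definition extension_value (u : nat -> R[i]) (u0 : R[i]) (m : int) : R[i] :=
  if m == 0 then u0 else u `|m|%N.

Lemma extension_subproof (L : {nonneg R}) (u : nat -> R[i]) (u0 : R[i])
    (uL : forall n, (0 < n)%N -> `|u n| <= (L%:num)%:C)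
    (u0L : `|u0| <= (L%:num)%:C) (m : int) :
  `|extension_value u u0 m| <= (L%:num)%:C.
Proof.
rewrite /extension_value; case: eqP => // /eqP m0.
by apply: uL; rewrite absz_gt0.
Qed.

Definition extension (L : {nonneg R}) (u : nat -> R[i]) (u0 : R[i])
    (uL : forall n, (0 < n)%N -> `|u n| <= (L%:num)%:C)
    (u0L : `|u0| <= (L%:num)%:C) : shift_space L :=
  fun m => to_closed_disc (extension_subproof uL u0L m).

Definition defines_furstenberg_system (L : {nonneg R}) (z : shift_space L)
    (N : nat -> nat) : Prop :=
  increasing_positive N /\
  exists nu : probability (borel (shift_space L)) R,
    weak_star_cvg (fun k => empirical (@left_shift L) z (N k)) nu.

End furstenberg.

(* Main.v *)
Require Import Defs.
From HB Require Import structures.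
From mathcomp Require Import all_boot all_order all_algebra.
From mathcomp Require Import all_classical all_reals all_analysis.
From mathcomp Require Import measurable_realfun complex.
From mathcomp Require Import zify ring lra.

(** The two conditions express that [u] has no correlation with the invariant
    functions of its Furstenberg systems.

    From short averages to orthogonality. Let [(X, T)] be a system of the class,
    [f] a continuous function, and suppose that the averages of [f (T^n x) u(n)]
    stay away from [0] along a sequence of lengths. After two extractions
    ([empirical_subsequence]) the empirical measures of [x] converge in [X], and
    those of the extension of [u] converge in the shift space. The limit in [X]
    is visible, hence [T] is the identity almost everywhere for it
    ([identity_ae]), so that [f (T^(n+h) x)] is close to [f (T^n x)] for most [n]
    ([orbit_almost_constant]). One may then replace [u(n)] by its average over
    [n+1, ..., n+H], which is small in quadratic mean by assumption
    ([almost_constant_orthogonal]).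

    From orthogonality to short averages. A sequence [a] in a disc, indexed by
    the integers and with [a(n+1) - a(n)] tending to [0], is observed along an
    orbit of a system of the class: add to the discrete orbit a disc of fixed
    points, at which the orbit accumulates; no finite invariant measure charges
    the orbit, so all of them live where the map is the identity
    ([slow_space_class_ID]). Hence [u] is orthogonal to all such sequences. Now
    let [A_H(n)] be the two-sided Fejer-type average of length [H], around [n],
    of the conjugate of [u]. It varies by [O(1/H)] when [n] or [H] increases by
    one, and its correlation with [u] is, up to a vanishing error, the quadratic
    mean of the averages of [u] of length [H] ([two_sided_correlation]). If this
    mean exceeds [eps] in the limit for infinitely many bad lengths [H], let
    [H(n)] grow by steps of one, waiting at each bad length until the average of
    [A_(H(j))(j) u(j)] over [j <= n] has real part at least [eps / 4]
    ([stair_unbounded], [stair_often]). The sequence [A_(H(n))(n)] varies slowly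
    and is not orthogonal to [u].

    Weak limits are obtained on the Cantor space, of which every compact metric
    space is a continuous image: frequencies of finite words converge along a
    diagonal subsequence ([frequency_limit]), and the limits are the cylinder
    masses of an image of Lebesgue measure on the unit interval
    ([cantor_measure_exists]). *)

Set Implicit Arguments.
Unset Strict Implicit.
Unset Printing Implicit Defensive.

Import Order.TTheory GRing.Theory Num.Theory numFieldNormedType.Exports.
Local Open Scope classical_set_scope.
Local Open Scope ring_scope.
Local Open Scope complex_scope.

(** * Averages of sequences *)

Lemma mean_upto_sumE (F : fieldType) (a : nat -> F) N :
  mean_upto a N = N%:R^-1 * \sum_(k < N) a k.+1.
Proof. by rewrite /mean_upto big_add1 big_mkord. Qed.

Lemma mean_upto_cst (F : numFieldType) (x : F) N :
  (0 < N)%N -> mean_upto (fun=> x) N = x.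
Proof.
move=> N0; rewrite mean_upto_sumE sumr_const card_ord -[x *+ N]mulr_natl mulrA.
by rewrite mulVf ?mul1r// pnatr_eq0 -lt0n.
Qed.

Lemma mean_uptoB (F : fieldType) (a b : nat -> F) N :
  mean_upto a N - mean_upto b N = mean_upto (fun n => a n - b n) N.
Proof. by rewrite /mean_upto -mulrBr sumrB. Qed.

Lemma mean_uptoD (F : fieldType) (a b : nat -> F) N :
  mean_upto a N + mean_upto b N = mean_upto (fun n => a n + b n) N.
Proof. by rewrite /mean_upto -mulrDr big_split. Qed.

Lemma mean_upto_sum (F : fieldType) (I : finType) (x : I -> F) (a : I -> nat -> F) N :
  mean_upto (fun n => \sum_i x i * a i n) N = \sum_i x i * mean_upto (a i) N.
Proof.
rewrite /mean_upto exchange_big mulr_sumr /=; apply: eq_bigr => i _.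
by rewrite -mulr_sumr mulrCA.
Qed.

Lemma eq_mean_upto (F : fieldType) (a b : nat -> F) N :
  (forall n, (0 < n <= N)%N -> a n = b n) -> mean_upto a N = mean_upto b N.
Proof. by move=> ab; rewrite /mean_upto; congr (_ * _); apply: eq_big_nat => n /ab. Qed.

Lemma ler_mean_upto (R : numFieldType) (a b : nat -> R) N :
  (forall n, (0 < n <= N)%N -> a n <= b n) -> mean_upto a N <= mean_upto b N.
Proof.
by move=> ab; rewrite /mean_upto ler_wpM2l// ?invr_ge0//; apply: ler_sum_nat => n /ab.
Qed.

Lemma ler_norm_mean_upto (R : numFieldType) (a : nat -> R) N :
  `|mean_upto a N| <= mean_upto (fun n => `|a n|) N.
Proof.
rewrite /mean_upto normrM ger0_norm ?invr_ge0// ler_wpM2l ?invr_ge0//.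
exact: ler_norm_sum.
Qed.

Lemma mean_upto_bound (R : numFieldType) (a : nat -> R) (e : R) N :
  0 <= e -> (forall n, (0 < n <= N)%N -> `|a n| <= e) -> `|mean_upto a N| <= e.
Proof.
move=> e0 ae; case: N ae => [_|N ae].
  by rewrite /mean_upto invr0 mul0r normr0.
rewrite (le_trans (ler_norm_mean_upto _ _))// -[leRHS](@mean_upto_cst _ e N.+1)//.
exact: ler_mean_upto.
Qed.

Lemma mean_upto_exchange (F : fieldType) (a : nat -> nat -> F) N H :
  mean_upto (fun n => mean_upto (a n) H) N = mean_upto (fun h => mean_upto (a ^~ h) N) H.
Proof.
rewrite /mean_upto -!mulr_sumr exchange_big mulrCA; congr (_ * _).
Qed.

(** The two sums differ by at most [h] terms at each end. *)
Lemma mean_upto_shift_bound (F : numFieldType) (a : nat -> F) (M : F) N h :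
  (forall n, (0 < n)%N -> `|a n| <= M) ->
  `|mean_upto (fun n => a (n + h)%N) N - mean_upto a N| <= N%:R^-1 * (M + M) *+ h.
Proof.
elim: h a => [|h IH] a aM.
  by rewrite mulr0n (@eq_mean_upto _ _ a) ?subrr ?normr0// => n _; rewrite addn0.
have -> : mean_upto (fun n => a (n + h.+1)%N) N = mean_upto (fun n => a (n + h).+1) N.
  by apply: eq_mean_upto => n _; rewrite addnS.
rewrite mulrS -(subrKA (mean_upto (fun n => a n.+1) N)) addrC.
rewrite (le_trans (ler_normD _ _))// lerD//.
  by apply: (IH (fun n => a n.+1)) => n _; exact: aM.
rewrite mean_uptoB /mean_upto normrM ger0_norm ?invr_ge0// ler_wpM2l ?invr_ge0//.
by rewrite telescope_sumr// (le_trans (ler_normB _ _))// lerD// aM.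
Qed.

Lemma cvg_invn (R : realType) : (n%:R^-1 : R) @[n --> \oo] --> 0.
Proof.
apply/(gtr0_cvgV0 (f := fun n => n%:R)); last exact: cvgr_idn.
by exists 1%N => // n /= n0; rewrite ltr0n.
Qed.

(** * Measures on the Cantor space with prescribed cylinder masses *)

Section tree.
Context {R : realType} (mu : seq bool -> R).
Hypotheses (mu_ge0 : forall w, 0 <= mu w) (mu_nil : mu [::] = 1).
Hypothesis mu_split : forall w, mu w = mu (false :: w) + mu (true :: w).

(** Words are read backwards: the head is the last letter. The words of a
    given length, in lexicographic order, have as masses the lengths of
    consecutive subintervals of [0, 1); this is where such an interval starts. *)
Fixpoint left_end (w : seq bool) : R :=
  if w is b :: w' then left_end w' + (if b then mu (false :: w') else 0) else 0.

(** For [t] in [0, 1), the word of length [d] whose interval contains [t]. *)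
Fixpoint path_to (t : R) (d : nat) : seq bool :=
  if d is d'.+1 then
    let w := path_to t d' in (left_end w + mu (false :: w) <= t) :: w
  else [::].

(** A quantile function for the lexicographic order: it pushes Lebesgue
    measure on [0, 1) to the measure with cylinder masses [mu]. *)
Definition branch (t : R) : cantor_space :=
  fun d => left_end (path_to t d) + mu (false :: path_to t d) <= t.

Definition interval_of w : set R := `[left_end w, left_end w + mu w[%classic.

Lemma path_to_interval t d : t \in `[0, 1[ -> interval_of (path_to t d) t.
Proof.
rewrite in_itv /= => t01; rewrite /interval_of /=; elim: d => [|d].
  by rewrite /= mu_nil in_itv /= add0r.
rewrite /= !in_itv /=; set w := path_to t d.
rewrite (mu_split w) => /andP[h1 h2].
case: (lerP (left_end w + mu (false :: w)) t) => h; first by rewrite h /= -addrA.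
by rewrite addr0 h1.
Qed.

Lemma path_to_uniq t w : interval_of w t -> path_to t (size w) = w.
Proof.
rewrite /interval_of /=; elim: w => [//|b w IH] /=.
rewrite !in_itv /= => /andP[h1 h2].
have mf := mu_ge0 (false :: w); have mt := mu_ge0 (true :: w).
have {}IH : path_to t (size w) = w.
  apply: IH; rewrite in_itv /= (mu_split w).
  by case: b h1 h2 => h1 h2; apply/andP; split; lra.
rewrite IH; congr (_ :: _); case: b h1 h2 => h1 h2; first by rewrite h1.
by apply/negbTE; rewrite -ltNge; lra.
Qed.

End tree.

(** The first [d] letters of [c], the last one first, so that extending a
    word is [cons]. *)
Fixpoint word (c : cantor_space) (d : nat) : seq bool :=
  if d is d'.+1 then c d' :: word c d' else [::].

Definition cylinder (w : seq bool) : set cantor_space :=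
  [set c | word c (size w) = w].

Lemma word_branch (R : realType) (mu : seq bool -> R) t d :
  word (branch mu t) d = path_to mu t d.
Proof. by elim: d => //= d ->. Qed.

Lemma size_word c d : size (word c d) = d.
Proof. by elim: d => //= d ->. Qed.

Lemma cylinder_word c d : cylinder (word c d) c.
Proof. by rewrite /cylinder /= size_word. Qed.

Lemma wordP (c c' : cantor_space) d :
  word c d = word c' d <-> forall i, (i < d)%N -> c i = c' i.
Proof.
elim: d => [|d IH] /=; first by split.
split=> [[h1 /IH h2] i|h].
  by rewrite ltnS leq_eqVlt => /orP[/eqP->//|/h2].
congr (_ :: _); first exact: h.
by apply/IH => i id; apply: h; rewrite (ltn_trans id).
Qed.

Lemma cylinderP (c c' : cantor_space) d :
  cylinder (word c d) c' <-> forall i, (i < d)%N -> c' i = c i.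
Proof. by rewrite -wordP /cylinder /mkset size_word. Qed.

(** The cylinders around [c] form a filter basis which converges to [c]
    coordinatewise, hence refines the neighbourhoods of [c]. *)
Lemma nbhs_cylinder (c : cantor_space) (U : set cantor_space) :
  nbhs c U -> exists d, cylinder (word c d) `<=` U.
Proof.
pose G : set_system cantor_space :=
  filter_from [set: nat] (fun d => cylinder (word c d)).
have GF : Filter G.
  apply: filter_from_filter; first by exists 0%N.
  move=> i j _ _; exists (maxn i j) => // c' /cylinderP h.
  by split; apply/cylinderP => k kd; apply: h; rewrite leq_max kd ?orbT.
suff : G --> c by move=> /[apply] -[d _ dU]; exists d.
apply/cvg_sup => i; apply/cvg_image.
  by rewrite eqEsubset; split => // b _; exists (fun=> b).
move=> A /= Aci.
exists [set c' | A (c' i)]; last first.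
  rewrite eqEsubset; split => [b [c' /= + <-//]|b Ab].
  by exists (fun=> b).
exists i.+1 => // c' /cylinderP /(_ i (ltnSn i)) /= ->.
exact: nbhs_singleton.
Qed.

Lemma open_cylinder w : open (cylinder w).
Proof.
elim: w => [|b w IH].
  rewrite (_ : cylinder _ = setT); first exact: openT.
  by apply/seteqP; split.
rewrite (_ : cylinder _ = cylinder w `&` proj (size w) @^-1` [set b]).
  apply: openI => //; apply: open_comp => [? _|]; first exact: proj_continuous.
  exact: discrete_open.
by apply/seteqP; split => c; rewrite /cylinder /= => -[h1 h2]; [split|congr (_ :: _)].
Qed.

Section cantor_measure.
Context {R : realType}.

Lemma measurable_open (X : ptopologicalType) (U : set X) :
  open U -> measurable (U : set (borel X)).
Proof. by move=> oU; apply: sub_sigma_algebra. Qed.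

Lemma measurable_continuous (X Y : ptopologicalType) (f : X -> Y) :
  continuous f -> measurable_fun [set: borel X] (f : borel X -> borel Y).
Proof.
move=> cf.
apply: (@measurability _ _ (borel X) (borel Y) setT f (@open Y)) => //.
move=> _ [B oB <-].
rewrite setTI; apply: measurable_open.
by apply: open_comp => // x _; exact: cf.
Qed.

Let unit_interval : set (measurableTypeR R) := `[0%R, 1%R[%classic.
Let munit : measurable unit_interval. Proof. exact: measurable_itv. Qed.

Definition unit_lebesgue := mrestr (@lebesgue_measure R) munit.

HB.instance Definition _ := Measure.on unit_lebesgue.

Let unit_lebesgue_setT : unit_lebesgue setT = 1%E.
Proof.
by rewrite /unit_lebesgue /mrestr setTI lebesgue_measure_itv /= lte_fin ltr01 oppr0 adde0.
Qed.

HB.instance Definition _ :=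
  Measure_isProbability.Build _ _ _ unit_lebesgue unit_lebesgue_setT.

Variable (mu : seq bool -> R).
Hypotheses (mu_ge0 : forall w, 0 <= mu w) (mu_nil : mu [::] = 1).
Hypothesis mu_split : forall w, mu w = mu (false :: w) + mu (true :: w).

Lemma measurable_branch :
  measurable_fun [set: measurableTypeR R] (branch mu : _ -> borel cantor_space).
Proof.
have mcyl w : measurable ((branch mu @^-1` cylinder w) : set (measurableTypeR R)).
  elim: w => [|b w IH].
    by rewrite (_ : _ @^-1` _ = setT)//; apply/seteqP; split.
  rewrite (_ : _ @^-1` _ = (branch mu @^-1` cylinder w) `&`
     (if b then `[left_end mu w + mu (false :: w), +oo[%classic
      else `]-oo, left_end mu w + mu (false :: w)[%classic)).
    by apply: measurableI => //; case: (b); exact: measurable_itv.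
  apply/seteqP; split => t; rewrite /cylinder /= /branch !word_branch.
    by case=> <- ->; split=> //; case: lerP => h /=; rewrite in_itv /= ?h.
  case=> ->; case: (b); rewrite /= in_itv /= ?andbT => h; first by rewrite h.
  by rewrite leNgt h.
apply: (@measurability _ _ (measurableTypeR R) (borel cantor_space) setT
  (branch mu) (@open cantor_space)) => // _ [U oU <-].
rewrite setTI (_ : U = \bigcup_(w in [set w | cylinder w `<=` U]) cylinder w).
  rewrite preimage_bigcup bigcup_mkcond.
  apply: countable_bigcupT_measurable => [|w]; last by case: ifP.
  exact: countableP.
apply/seteqP; split => [c Uc|c [w wU]]; last exact: wU.
have [d dU] := nbhs_cylinder (open_nbhs_nbhs (conj oU Uc)).
by exists (word c d) => //; exact: cylinder_word.
Qed.

(** Kolmogorov extension on the Cantor space, by a quantile transform: the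
    preimage of a cylinder under [branch mu] is, inside [0, 1), an interval of
    the prescribed length. *)
Lemma cantor_measure_exists :
  exists nu : probability (borel cantor_space) R,
    forall w, nu (cylinder w) = (mu w)%:E.
Proof.
pose phi : {mfun measurableTypeR R >-> borel cantor_space} :=
  HB.pack (branch mu : measurableTypeR R -> borel cantor_space)
   (isMeasurableFun.Build _ _ _ _ _ measurable_branch).
exists (distribution unit_lebesgue phi) => w.
rewrite /distribution /pushforward /= /unit_lebesgue /mrestr.
rewrite (_ : _ `&` _ = interval_of mu w).
  rewrite lebesgue_measure_itv /= lte_fin.
  case: ltrP => h; first by rewrite -EFinB addrAC subrr add0r.
  by rewrite gerDl in h; have -> : mu w = 0 by apply/le_anti; rewrite h mu_ge0.
apply/seteqP; split => t /=.
  rewrite /cylinder /= word_branch => -[<- t01]; exact: path_to_interval.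
move=> tw; split; first by rewrite /cylinder /= word_branch; exact: path_to_uniq.
have : forall w, interval_of mu w t -> interval_of mu [::] t.
  elim=> //= b v IH; rewrite /interval_of /= !in_itv /= => h; apply: IH.
  rewrite /interval_of /= in_itv /= (mu_split v).
  have mf := mu_ge0 (false :: v); have mt := mu_ge0 (true :: v).
  by case: b h => /andP[h1 h2]; apply/andP; split; lra.
by move=> /(_ _ tw); rewrite /interval_of /= mu_nil add0r.
Qed.

End cantor_measure.

(** * Diagonal subsequences and weak limits on the Cantor space *)

Lemma increasing_ge (N : nat -> nat) :
  {homo N : k l / (k < l)%N >-> (k < l)%N} -> forall k, (k <= N k)%N.
Proof. by move=> h; elim=> // k IH; apply: leq_ltn_trans (h _ _ (ltnSn k)). Qed.

Lemma increasing_cvg (N : nat -> nat) :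
  {homo N : k l / (k < l)%N >-> (k < l)%N} -> N k @[k --> \oo] --> \oo.
Proof.
move=> h A [n _ nA]; exists n => // k /= nk; apply: nA => /=.
exact: leq_trans nk (increasing_ge h k).
Qed.

Lemma increasing_of_step (N : nat -> nat) :
  (forall k, (N k < N k.+1)%N) -> {homo N : k l / (k < l)%N >-> (k < l)%N}.
Proof. by move=> h; apply: homo_ltn => //; exact: ltn_trans. Qed.

(** An ultrafilter on the indices gives all the limits at once; each of its
    sets is infinite, so that an index beyond [phi k] may be chosen for which the
    first [k.+1] coordinates are close to their limits. *)
Lemma diagonal_subsequence (R : realType) (a : nat -> nat -> R) :
  (forall k i, `|a k i| <= 1) ->
  exists (phi : nat -> nat) (l : nat -> R),
    {homo phi : k m / (k < m)%N >-> (k < m)%N} /\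
    forall i, a (phi k) i @[k --> \oo] --> l i.
Proof.
move=> a1.
have [U [uU ooU]] := ultraFilterLemma (@eventually_filter).
have pU : ProperFilter U := @ultra_proper _ _ uU.
have /choice[l lP] (i : nat) : exists l : R,
    forall e : R, 0 < e -> \forall k \near U, `|a k i - l| < e.
  have aU : (a ^~ i @ U) `[-1, 1]%classic.
    by rewrite /fmap /=; apply: filterE => k /=; rewrite in_itv /= -ler_norml.
  have [l [_ lU]] := segment_compact _ aU.
  exists l => e e0.
  have [//|/= nU] := @in_ultra_setVsetC _ _ [set k | `|a k i - l| < e] uU.
  have [x [/= le]] := lU [set x | ~ `|x - l| < e] _ nU (nbhsx_ballx l e e0).
  by rewrite /ball /= distrC.
have step (m j : nat) : exists k, (m < k)%N /\
    forall i : 'I_j, `|a k i - l i| < j.+1%:R^-1.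
  have : \forall k \near U, (m < k)%N /\
      forall i : 'I_j, `|a k i - l i| < j.+1%:R^-1.
    near=> k; split; near: k; first by apply: ooU; exists m.+1.
    by apply: filter_forall => i; exact: lP.
  exact: filter_ex.
have /choice[g gP] (mj : nat * nat) : exists k, (mj.1 < k)%N /\
    forall i : 'I_mj.2, `|a k i - l i| < mj.2.+1%:R^-1 by exact: step.
pose phi := fix phi k := if k is k'.+1 then g (phi k', k) else 0%N.
exists phi, l; split.
  by apply: increasing_of_step => k /=; have [] := gP (phi k, k.+1).
move=> i; rewrite -cvg_shiftS; apply/cvgrPdist_lt => e e0; near=> k.
have ik : (i < k.+1)%N by near: k; exists i.
have [_ /(_ (Ordinal ik)) /=] := gP (phi k, k.+1).
rewrite distrC => /lt_trans; apply.
apply: (@lt_trans _ _ k.+1%:R^-1); first by rewrite ltf_pV2 ?posrE // ltr_nat.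
near: k; exact: (near_infty_natSinv_lt (PosNum e0)).
Unshelve. all: by end_near. Qed.

Lemma integral_close d (T : measurableType d) (R : realType)
    (nu : probability T R) (f g : T -> R) (e : R) :
  nu.-integrable setT (EFin \o f) -> nu.-integrable setT (EFin \o g) ->
  (forall x, `|f x - g x| <= e) ->
  `|(\int[nu]_x f x)%R - (\int[nu]_x g x)%R| <= e.
Proof.
move=> fi gi fg; rewrite -RintegralB//.
have fgi : nu.-integrable setT (EFin \o (fun x => f x - g x)).
  exact: (integrableB _ fi gi).
apply: (le_trans (le_normr_Rintegral _ fgi)) => //.
have -> : e = (\int[nu]_(x in setT) e)%R.
  by rewrite Rintegral_cst//= [X in fine X]probability_setT mulr1.
apply: le_Rintegral => //; first exact: (integrable_norm fgi).
exact: finite_measure_integrable_cst.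
Qed.

Section integration.
Context {R : realType} {K : ptopologicalType}.

Lemma continuous_measurable_real (f : K -> R) :
  continuous f -> measurable_fun [set: borel K] (f : borel K -> R).
Proof.
move=> cf.
apply: (@measurability _ _ (borel K) (measurableTypeR R) setT f (@RGenOpens.G R)).
  exact: RGenOpens.measurableE.
move=> _ [_ [x [y ->]] <-].
rewrite setTI; apply: measurable_open.
by apply: open_comp => [? _|]; [exact: cf|exact: interval_open].
Qed.

Lemma continuous_bound (f : K -> R) :
  compact [set: K] -> continuous f -> exists2 M, 0 <= M & forall x, `|f x| <= M.
Proof.
move=> cK cf; have /compact_bounded[M [Mr hM]] : compact (range f).
  by apply: continuous_compact => //; exact: continuous_subspaceT.
have M1 : M < `|M| + 1 by rewrite (le_lt_trans (ler_norm _))// ltrDl.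
by exists (`|M| + 1) => [|x]; [rewrite addr_ge0|apply: (hM _ M1); exists x].
Qed.

Lemma continuous_integrable (nu : probability (borel K) R) (f : K -> R) :
  compact [set: K] -> continuous f ->
  nu.-integrable [set: borel K] (EFin \o (f : borel K -> R)).
Proof.
move=> cK cf; apply: measurable_bounded_integrable => //.
- by apply: (@le_lt_trans _ _ 1%E); [exact: probability_le1|exact: ltry].
- exact: continuous_measurable_real.
- have [M _ fM] := continuous_bound cK cf; exists M; split=> [|x Mx y _]; first exact: num_real.
  exact: le_trans (fM y) (ltW Mx).
Qed.
End integration.

(** Uniform continuity in terms of common initial words: otherwise pairs with
    longer and longer common words and distant values would accumulate at a
    point of discontinuity. *)
Lemma cantor_uniform (R : realType) (F : cantor_space -> R) (e : R) :
  continuous F -> 0 < e ->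
  exists d, forall c c', word c d = word c' d -> `|F c - F c'| < e.
Proof.
move=> cF e0; apply: contrapT => /forallNP h.
have /choice[p pP] (d : nat) : exists p : cantor_space * cantor_space,
    word p.1 d = word p.2 d /\ e <= `|F p.1 - F p.2|.
  have /existsNP[c /existsNP[c' /not_implyP[cc' /negP]]] := h d.
  by rewrite -leNgt => Fe; exists (c, c').
have [|c [_ /= cc]] := @cantor_space_compact (fst (p d) @[d --> \oo]) _.
  exact: filterT.
have e2 : 0 < e / 2 by rewrite divr_gt0.
have /nbhs_cylinder[m mF] := cF c _ (nbhsx_ballx (F c) _ e2).
have nbm : nbhs c (cylinder (word c m)).
  by apply: open_nbhs_nbhs; split; [exact: open_cylinder|exact: cylinder_word].
have mm : (fst (p d) @[d --> \oo]) [set fst (p d) | d in [set d | (m <= d)%N]].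
  by exists m => // d /= md; exists d.
have [_ [[d /= md <-] c1]] := cc _ _ mm nbm.
have [pd] := pP d; apply/negP; rewrite -ltNge.
have c2 : cylinder (word c m) (p d).2.
  move: c1 pd => /cylinderP c1 /wordP pd; apply/cylinderP => i im.
  by rewrite -c1// pd// (leq_trans im).
have := mF _ c1; have := mF _ c2; rewrite /ball /= => h2 h1.
rewrite (_ : _ - _ = (F c - F (p d).2) - (F c - F (p d).1)); last by ring.
by apply: (le_lt_trans (ler_normB _ _)); rewrite (splitr e) ltrD.
Qed.

Definition extend (w : seq bool) : cantor_space :=
  fun i => nth false w (size w - i.+1).

Lemma word_extend w : word (extend w) (size w) = w.
Proof.
elim: w => //= b w IH; congr (_ :: _); first by rewrite /extend /= subnn.
rewrite -[RHS]IH; apply/wordP => i iw; rewrite /extend /=.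
by rewrite subSS -[in LHS](subnSK iw).
Qed.

Definition frequency (R : fieldType) (c : nat -> cantor_space) (N : nat)
    (w : seq bool) : R :=
  mean_upto (fun n => (word (c n) (size w) == w)%:R) N.

Lemma cylinder_decomposition (R : fieldType) (F : cantor_space -> R) d c :
  F (extend (word c d)) =
  \sum_(w : d.-tuple bool) F (extend w) * (word c (size w) == w)%:R.
Proof.
pose v : d.-tuple bool := Tuple (introT eqP (size_word c d)).
rewrite (bigD1 v)//= big1 ?addr0 => [|w wv].
  by rewrite !size_word eqxx mulr1.
rewrite size_tuple (_ : (_ == _) = false) ?mulr0//.
by apply: contraNF wv => /eqP vw; apply/eqP/val_inj.
Qed.

(** Frequencies of words are additive at each [N], so their limits satisfy
    the compatibility conditions required by [cantor_measure_exists]. *)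
Lemma frequency_limit (R : realType) (c : nat -> cantor_space) (N : nat -> nat) :
  increasing_positive N ->
  exists (phi : nat -> nat) (mu : seq bool -> R),
    [/\ {homo phi : k m / (k < m)%N >-> (k < m)%N},
      (forall w, frequency R c (N (phi k)) w @[k --> \oo] --> mu w),
      (forall w, 0 <= mu w), mu [::] = 1
    & forall w, mu w = mu (false :: w) + mu (true :: w)].
Proof.
move=> [N0 Ninc].
have [|phi [l [phi_inc al]]] := @diagonal_subsequence R
    (fun k i => if unpickle i is Some w then frequency R c (N k) w else 0).
  move=> k i; case: (unpickle i) => [w|]; last by rewrite normr0.
  apply: mean_upto_bound => // n _.
  by case: (_ == _); rewrite ?normr1 ?normr0.
have fl w : frequency R c (N (phi k)) w @[k --> \oo] --> l (pickle w).
  by have := al (pickle w); rewrite pickleK.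
exists phi, (l \o pickle); split => //= [w||w].
- rewrite -(cvg_lim _ (fl w))//; apply: limr_ge; first exact: cvgP (fl w).
  apply: nearW => k; rewrite /frequency mulr_ge0 ?invr_ge0// sumr_ge0// => n _.
- have := fl [::]; rewrite (_ : (fun k => _) = fun=> 1).
    by move=> /cvg_lim <-//; rewrite lim_cst.
  apply/funext => k; rewrite /frequency /=; apply: mean_upto_cst.
  by apply: leq_trans N0 _; case: (phi k) => [//|j]; apply: ltnW; exact: Ninc.
- have fE : (fun k => frequency R c (N (phi k)) w) = fun k =>
      frequency R c (N (phi k)) (false :: w) + frequency R c (N (phi k)) (true :: w).
    apply/funext => k; rewrite /frequency mean_uptoD; apply: eq_mean_upto => n _ /=.
    by rewrite !eqseq_cons; case: (c n (size w)); rewrite /= ?add0r ?addr0.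
  rewrite -(cvg_lim _ (fl w))// fE; apply: cvg_lim => //.
  by apply: cvgD; exact: fl.
Qed.

(** Up to a uniformly small error, a continuous function depends on finitely
    many letters, and then its averages are combinations of word frequencies. *)
Lemma cantor_subsequence (R : realType) (c : nat -> cantor_space) (N : nat -> nat) :
  increasing_positive N ->
  exists (phi : nat -> nat) (nu : probability (borel cantor_space) R),
    {homo phi : k m / (k < m)%N >-> (k < m)%N} /\
    forall F : cantor_space -> R, continuous F ->
      mean_upto (fun n => F (c n)) (N (phi k)) @[k --> \oo] --> (\int[nu]_x F x)%R.
Proof.
move=> /(frequency_limit R c)[phi [mu [phi_inc fmu mu0 mu1 muS]]].
have [nu nuE] := cantor_measure_exists mu0 mu1 muS.
exists phi, nu; split => // F cF.
apply/cvgrPdist_le => e e0; have e3 : 0 < e / 3 by rewrite divr_gt0.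
have [d Fd] := cantor_uniform cF e3.
have Fext x : `|F x - F (extend (word x d))| <= e / 3.
  by apply/ltW/Fd; have := word_extend (word x d); rewrite size_word => ->.
pose S k := \sum_(w : d.-tuple bool) F (extend w) * frequency R c (N (phi k)) w.
pose L := \sum_(w : d.-tuple bool) F (extend w) * mu w.
have SL : S k @[k --> \oo] --> L.
  apply: cvg_big => [|w _]; first exact: add_continuous.
  by apply: cvgM; [exact: cvg_cst|exact: fmu].
have SE k : S k = mean_upto (fun n => F (extend (word (c n) d))) (N (phi k)).
  rewrite /S -mean_upto_sum; apply: eq_mean_upto => n _.
  by rewrite cylinder_decomposition.
have mcyl w : measurable (cylinder w : set (borel cantor_space)).
  by apply: (@measurable_open cantor_space); exact: open_cylinder.
have iw (w : d.-tuple bool) : nu.-integrable setT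
    (fun x => (F (extend w))%:E * (\1_(cylinder w) x)%:E)%E.
  apply: integrableZl => //; exact: integrable_indic.
have extE : (fun x : borel cantor_space => (F (extend (word x d)))%:E) =
    (fun x => \sum_(w : d.-tuple bool) (F (extend w))%:E * (\1_(cylinder w) x)%:E)%E.
  apply/funext => x; rewrite cylinder_decomposition -sumEFin; apply: eq_bigr => w _.
  rewrite indicE EFinM; congr (_ * (_ : bool)%:R%:E)%E.
  by apply/eqP/idP => [/mem_set|/set_mem].
have iext : nu.-integrable setT (EFin \o (fun x => F (extend (word x d)))).
  by rewrite /comp extE; apply: integrable_sum => // w _; exact: iw.
have LE : L = (\int[nu]_x F (extend (word x d)))%R.
  rewrite /Rintegral extE integral_sum// [X in fine X](_ : _ = L%:E)//.
  rewrite -sumEFin; apply: eq_bigr => w _; rewrite integralZl//; last first.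
    exact: integrable_indic.
  by rewrite integral_indic// setIT EFinM -nuE.
near=> k.
have h1 : `|(\int[nu]_x F x)%R - L| <= e / 3.
  rewrite LE; apply: integral_close => //.
  exact: continuous_integrable cantor_space_compact cF.
have h2 : `|L - S k| <= e / 3.
  by near: k; move/cvgrPdist_le : SL; exact.
have h3 : `|S k - mean_upto (fun n => F (c n)) (N (phi k))| <= e / 3.
  rewrite SE mean_uptoB; apply: mean_upto_bound; first exact: ltW.
  by move=> n _; rewrite distrC.
rewrite (_ : _ - _ = ((\int[nu]_x F x)%R - L) + (L - S k) +
  (S k - mean_upto (fun n => F (c n)) (N (phi k)))); last by ring.
rewrite (le_trans (ler_normD _ _))// (_ : e = e / 3 + e / 3 + e / 3); last by field.
by rewrite lerD// (le_trans (ler_normD _ _))// lerD.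
Unshelve. all: by end_near. Qed.

(** * Weak limits of empirical measures *)

Lemma integral_empirical (R : realType) (X : ptopologicalType) (T : X -> X)
    (x : X) (N : nat) (f : X -> R) :
  continuous f ->
  (\int[empirical T x N]_y (f y)%:E)%E = (mean_upto (fun n => f (iter n T x)) N)%:E.
Proof.
move=> /continuous_measurable_real mf.
have ge0E (h : borel X -> \bar R) : measurable_fun setT h -> (forall y, 0 <= h y)%E ->
    (\int[empirical T x N]_y h y)%E =
    (N%:R^-1%:E * \sum_(k < N) h (iter k.+1 T x))%E.
  move=> mh h0; rewrite ge0_integral_mscale//; congr (_ * _)%E.
  rewrite ge0_integral_measure_sum//; apply: eq_bigr => k _.
  by rewrite integral_dirac// diracT mul1e.
have mfE : measurable_fun setT (EFin \o (f : borel X -> R)).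
  exact/measurable_EFinP.
rewrite integralE !ge0E; first last.
- by move=> y; exact: funepos_ge0.
- exact: measurable_funepos.
- by move=> y; exact: funeneg_ge0.
- exact: measurable_funeneg.
rewrite mean_upto_sumE.
rewrite [X in (_ * X - _)%E](_ :
    _ = (\sum_(k < N) Num.max (f (iter k.+1 T x)) 0)%:E); last first.
  by rewrite -sumEFin; apply: eq_bigr => k _; rewrite funeposE EFin_max.
rewrite [X in (_ - _ * X)%E](_ :
    _ = (\sum_(k < N) Num.max (- f (iter k.+1 T x)) 0)%:E); last first.
  by rewrite -sumEFin; apply: eq_bigr => k _; rewrite funenegE EFin_max.
rewrite -!EFinM -EFinB -mulrBr -sumrB; congr (_ * _)%:E; apply: eq_bigr => k _.
by case: (lerP 0 (f (iter k.+1 T x))) => h; rewrite ?oppr_le0 //;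
  case: (lerP (- f (iter k.+1 T x)) 0) => h'; lra.
Qed.

(** Sequential weak-* compactness for the empirical measures of an orbit: lift
    the orbit to the Cantor space, extract a limit there and push it forward. *)
Theorem empirical_subsequence (R : realType) (X : ptopologicalType)
    (g : cantor_space -> X) (T : X -> X) (x : X) (N : nat -> nat) :
  continuous g -> (forall y, exists c, g c = y) -> increasing_positive N ->
  exists (phi : nat -> nat) (nu : probability (borel X) R),
    {homo phi : k m / (k < m)%N >-> (k < m)%N} /\
    weak_star_cvg (fun k => empirical T x (N (phi k))) nu.
Proof.
move=> cg /choice[s sK] /(cantor_subsequence R (fun n => s (iter n T x))).
move=> [phi [kappa [phi_inc kappaE]]].
pose gm : {mfun borel cantor_space >-> borel X} :=
  HB.pack (g : borel cantor_space -> borel X)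
   (isMeasurableFun.Build _ _ _ _ _ (measurable_continuous cg)).
exists phi, (distribution kappa gm); split => // f cf.
have cfg : continuous (f \o g) by move=> c; exact: continuous_comp (cg c) (cf _).
have ifg := continuous_integrable kappa cantor_space_compact cfg.
rewrite integral_pushforward//; last first.
  by apply/measurable_EFinP; exact: continuous_measurable_real cf.
under eq_fun do rewrite integral_empirical//.
have -> : (\int[kappa]_(y in gm @^-1` [set: borel X]) ((EFin \o f) \o gm) y)%E =
   (\int[kappa]_y f (g y))%R%:E.
  rewrite /Rintegral fineK ?preimage_setT//.
  exact: integrable_fin_num.
apply: cvg_EFin; first exact: nearW.
rewrite (_ : _ \o _ = fun k => mean_upto (fun n => (f \o g) (s (iter n T x))) (N (phi k))).
  exact: kappaE.
by apply/funext => k /=; apply: eq_mean_upto => n _; rewrite sK.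
Qed.

(** * Complex moduli and images of the Cantor space *)

Section cabs.
Context {R : realType}.
Implicit Types z w : R[i].

(** The modulus as a real number; the norm of a complex number is itself
    complex. *)
Definition cabs z : R := complex.Re `|z|.

Lemma norm_cabsE z : `|z| = (cabs z)%:C.
Proof. by []. Qed.

Lemma cabs_ge0 z : 0 <= cabs z.
Proof. by rewrite -lecR -norm_cabsE normr_ge0. Qed.

Lemma cabsD z w : cabs (z + w) <= cabs z + cabs w.
Proof. by rewrite -lecR rmorphD /= -!norm_cabsE ler_normD. Qed.

Lemma cabsB z w : cabs (z - w) <= cabs z + cabs w.
Proof. by rewrite -lecR rmorphD /= -!norm_cabsE ler_normB. Qed.

Lemma cabsM z w : cabs (z * w) = cabs z * cabs w.
Proof.
have := normrM z w; rewrite !norm_cabsE -rmorphM /= => h.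
exact: (congr1 (@complex.Re R) h).
Qed.

Lemma cabs_real (x : R) : cabs x%:C = `|x|.
Proof. by rewrite /cabs /= expr0n addr0 sqrtr_sqr. Qed.

Lemma cabs0 : cabs 0 = 0. Proof. by rewrite /cabs normr0. Qed.

Lemma cabsN z : cabs (- z) = cabs z. Proof. by rewrite /cabs normrN. Qed.

Lemma cabs_distC z w : cabs (z - w) = cabs (w - z).
Proof. by rewrite -cabsN opprB. Qed.

Lemma cabs_eq0 z : cabs z = 0 -> z = 0.
Proof. by move=> h; apply/normr0_eq0; rewrite norm_cabsE h. Qed.

Lemma cabs_conj z : cabs z^* = cabs z.
Proof. by case: z => a b; rewrite /cabs /= sqrrN. Qed.

Lemma cabs_Re z : `|complex.Re z| <= cabs z.
Proof. by rewrite -lecR -norm_cabsE; exact: normc_ge_Re. Qed.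

Lemma ler_cabs z (x : R) : (`|z| <= x%:C) = (cabs z <= x).
Proof. by rewrite norm_cabsE lecR. Qed.

Lemma cabs_sum (I : Type) (s : seq I) (P : pred I) (f : I -> R[i]) :
  cabs (\sum_(i <- s | P i) f i) <= \sum_(i <- s | P i) cabs (f i).
Proof.
elim/big_rec2: _ => [|i x y _ h]; first by rewrite cabs0.
by apply: le_trans (cabsD _ _) _; rewrite lerD2l.
Qed.

Lemma cvg_cabsP (T : Type) (F : set_system T) (FF : Filter F) (f : T -> R[i]) l :
  f x @[x --> F] --> l <-> forall e : R, 0 < e -> \forall x \near F, cabs (l - f x) < e.
Proof.
split=> [/cvgrPdist_lt h e e0|h].
  have : 0 < e%:C :> R[i] by rewrite ltcR.
  by move=> /h; apply: filterS => x; rewrite norm_cabsE ltcR.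
apply/cvgrPdist_lt => -[e e'] /=; rewrite ltcE /= => /andP[/eqP -> e0].
by have := h _ e0; apply: filterS => x; rewrite norm_cabsE ltcR.
Qed.

Lemma cabs_Im z : `|complex.Im z| <= cabs z.
Proof.
rewrite (_ : complex.Im z = - complex.Re ('i * z)).
  rewrite normrN (le_trans (cabs_Re _))// cabsM.
  by rewrite [cabs 'i]/cabs /= expr0n /= add0r expr1n sqrtr1 mul1r.
by case: z => a b; rewrite /= mul0r mul1r sub0r opprK.
Qed.

Lemma cabs_continuous : continuous cabs.
Proof.
move=> z; apply/(@cvgrPdist_lt _ _ _ (nbhs z) (nbhs_filter z)) => e e0.
have := (@cvg_cabsP _ (nbhs z) (nbhs_filter z) (fun w => w) z).1 (fun _ => id) e e0.
apply: filterS => w; apply: le_lt_trans; rewrite ler_norml.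
have h1 := cabsD (z - w) w; have h2 := cabsD (w - z) z.
by rewrite !subrK in h1 h2; rewrite cabs_distC in h2; apply/andP; split; lra.
Qed.

Lemma complex_continuous : continuous (fun p : R * R => p.1 +i* p.2).
Proof.
move=> [a b]; apply/cvg_cabsP => e e0.
have e2 : 0 < e / 2 by rewrite divr_gt0.
near=> p.
rewrite (_ : _ - _ = (a - p.1)%:C + 'i * (b - p.2)%:C); last first.
  by apply/eqP; rewrite eq_complex /= !(mul0r, mul1r, mulr0, subr0, add0r, addr0, oppr0) !eqxx.
apply: (le_lt_trans (cabsD _ _)); rewrite cabsM !cabs_real.
have -> : cabs 'i = 1 by rewrite /cabs /= expr0n /= add0r expr1n sqrtr1.
rewrite mul1r (splitr e) ltrD//; near: p.
  have : (@fst R R) p @[p --> nbhs (a, b)] --> a by exact: cvg_fst.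
  by move/cvgrPdist_lt => /(_ _ e2).
have : (@snd R R) p @[p --> nbhs (a, b)] --> b by exact: cvg_snd.
by move/cvgrPdist_lt => /(_ _ e2).
Unshelve. all: by end_near. Qed.

End cabs.

Lemma cantor_image_compact (X : topologicalType) (g : cantor_space -> X) :
  continuous g -> (forall y, exists c, g c = y) -> compact [set: X].
Proof.
move=> cg gs; have -> : [set: X] = range g.
  by apply/seteqP; split => // y _; have [c <-] := gs y; exists c.
apply: continuous_compact; first exact: continuous_subspaceT.
exact: cantor_space_compact.
Qed.

Section cantor_surjections.
Context {R : realType}.

Lemma compact_metric_cantor (X : pmetricType R) : compact [set: X] ->
  exists2 g : cantor_space -> X, continuous g & forall y, exists c, g c = y.
Proof.
move=> /(cantor_surj (T := X))[|g cg].
  exact: metric_hausdorff.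
exists g => // y; have [c _ <-] := @surj _ _ _ _ g y I.
by exists c.
Qed.

Lemma compact_set_type (X : topologicalType) (A : set X) :
  compact A -> compact [set: set_type A].
Proof.
move=> cA F FF _.
have [|p [Ap clp]] := cA (set_val @ F) _.
  by rewrite /fmap /=; apply: filterE => x; exact: set_valP.
exists (exist _ p (mem_set Ap)); split => // B C FB.
rewrite nbhsE /= => -[_ [[/= W oW <-] Wp] WC].
have nW : nbhs p W by apply: open_nbhs_nbhs.
have FvB : (set_val @ F) (set_val @` B).
  by rewrite /fmap /=; apply: filterS FB => x Bx; exists x.
have [_ [[x Bx <-] Wx]] := clp _ _ FvB nW.
by exists x; split => //; exact: WC.
Qed.

Lemma hausdorff_set_type (X : topologicalType) (A : set X) :
  hausdorff_space X -> hausdorff_space (set_type A).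
Proof.
move=> hX p q clpq; apply: val_inj; apply: hX => U V Up Vq.
have cv : continuous (@set_val X A) by exact: initial_continuous.
by have [x [Ux Vx]] := clpq _ _ (cv p _ Up) (cv q _ Vq); exists (set_val x).
Qed.

Definition disc_val (L : {nonneg R}) (z : closed_disc L) : R[i] := set_val z.

Lemma disc_val_continuous L : continuous (@disc_val L).
Proof. exact: initial_continuous. Qed.

Lemma continuous_to_disc L (X : topologicalType) (f : X -> closed_disc L) :
  continuous (@disc_val L \o f) -> continuous f.
Proof. exact: continuous_comp_initial. Qed.

(** A disc of [R * R] is a compact metric space over [R], so that the
    Alexandroff-Hausdorff theorem applies to it; the metric of [R[i]] takes
    complex values. *)
Lemma closed_disc_cantor (L : {nonneg R}) :
  exists2 g : cantor_space -> closed_disc L, continuous g & forall y, exists c, g c = y.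
Proof.
have r0 : 0 <= L%:num by [].
pose D : set (R * R) := [set p | cabs (p.1 +i* p.2) <= L%:num].
have cD : compact D.
  apply: (@subclosed_compact _ _ (`[- L%:num, L%:num] `*` `[- L%:num, L%:num])%classic).
  - rewrite (_ : D = (fun p => cabs (p.1 +i* p.2)) @^-1` [set x | x <= L%:num])//.
    apply: preimage_closed; last exact: closed_le.
    move=> p _; apply: continuous_comp; first exact: complex_continuous.
    exact: cabs_continuous.
  - by apply: compact_setX; exact: segment_compact.
  - move=> p; rewrite /D /= => h; rewrite !in_itv /= -!ler_norml.
    by split; apply: le_trans h; [exact: (cabs_Re (_ +i* _))|exact: (cabs_Im (_ +i* _))].
have D0 : D (0, 0) by rewrite /D /= (_ : _ +i* _ = 0) ?cabs0.
pose DT : pseudoPMetricType R :=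
  HB.pack (set_type D)
    (isPointed.Build (set_type D) (exist (fun p => p \in D) _ (mem_set D0))).
have hD : hausdorff_space DT by apply: hausdorff_set_type; exact: norm_hausdorff.
have [g cg] := cantor_surj (compact_set_type cD : compact [set: DT]) hD.
have DL (p : set_type D) : `|(set_val p).1 +i* (set_val p).2 : R[i]| <= (L%:num)%:C.
  by rewrite ler_cabs; exact: (set_valP p).
pose h (p : set_type D) : closed_disc L := to_closed_disc (DL p).
exists (h \o g).
  move=> c; apply: continuous_comp; first exact: cg.
  apply: continuous_to_disc => p.
  apply: (@continuous_comp _ _ _ (@set_val _ D) (fun p => p.1 +i* p.2)).
    exact: initial_continuous.
  exact: complex_continuous.
case=> -[a b] zL; have abD : D (a, b).
  by rewrite /D /= -ler_cabs; exact: set_mem zL.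
have [c _ gc] := @surj _ _ _ _ g (exist (fun p => p \in D) _ (mem_set abD)) I.
by exists c; apply: val_inj; rewrite /= gc.
Qed.

Lemma continuous_to_prod (I : Type) (T : I -> topologicalType) (X : topologicalType)
    (f : X -> prod_topology T) :
  (forall i, continuous (fun x => f x i)) -> continuous f.
Proof.
move=> cf x; apply/cvg_sup => i.
by apply: (@continuous_comp_initial _ X (T i) (fun h => h i)); exact: cf.
Qed.

(** A point of the Cantor space encodes countably many others, through a
    bijection of the index set; each of them is mapped to one coordinate. *)
Lemma shift_space_cantor (L : {nonneg R}) :
  exists2 g : cantor_space -> shift_space L, continuous g & forall y, exists c, g c = y.
Proof.
have [g cg gs] := closed_disc_cantor L.
exists (fun c m => g (fun i => c (pickle (m, i)))).
  apply: (@continuous_to_prod int (fun=> closed_disc L)) => m c.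
  pose r (c : cantor_space) : cantor_space := fun i => c (pickle (m, i)).
  have cr : continuous r.
    apply: (@continuous_to_prod nat (fun=> bool)) => i c'.
    exact: (@proj_continuous nat (fun=> bool) (pickle (m, i))).
  exact: (@continuous_comp _ _ _ r g) (cr c) (cg _).
move=> y; have /choice[s sE] := fun m => gs (y m).
exists (fun n => if unpickle n is Some (m, i) then s m i else false).
apply/funext => m; rewrite -sE; congr g.
by apply/funext => i; rewrite pickleK.
Qed.

Lemma shift_space_eval_continuous (L : {nonneg R}) (m : int) :
  continuous (fun z : shift_space L => disc_val (z m)).
Proof.
move=> z; apply: (@continuous_comp _ _ _ (fun z : shift_space L => z m)).
  exact: (@proj_continuous int (fun=> closed_disc L)).
exact: disc_val_continuous.
Qed.

Lemma iter_left_shift (L : {nonneg R}) n (z : shift_space L) m :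
  iter n (@left_shift R L) z m = z (m + n%:Z).
Proof.
elim: n m => [|n IH] m; first by rewrite addr0.
by rewrite iterS /left_shift IH -addrA -intS.
Qed.

End cantor_surjections.

(** * Limit measures of orbits in a system of the class *)

Lemma nbhs_mdist (R : realType) (X : pmetricType R) (x : X) (P : set X) :
  nbhs x P <-> exists2 e, 0 < e & forall y, mdist x y < e -> P y.
Proof.
split=> [/(metricType_numDomainType.nbhs_mdistP x P)|] [e e0 eP].
  by exists e => // y /eP.
by apply/(metricType_numDomainType.nbhs_mdistP x P); exists e.
Qed.

Lemma lipschitz_continuous (R : realType) (X : pmetricType R) (f : X -> R) (c : R) :
  (forall x y, f x - f y <= c * mdist x y) -> continuous f.
Proof.
move=> fc x; apply/cvgrPdist_lt => e e0.
have c0 : 0 < `|c| + 1 by rewrite ltr_wpDl.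
apply/nbhs_mdist; exists (e / (`|c| + 1)); first by rewrite divr_gt0.
move=> y; rewrite ltr_pdivlMr// => xy.
have cle : c * mdist x y <= mdist x y * (`|c| + 1).
  rewrite mulrC ler_wpM2l ?mdist_ge0//.
  by rewrite (le_trans (ler_norm _))// lerDl.
have h1 := fc x y; have := fc y x; rewrite metric_sym => h2.
by rewrite ltr_norml; apply/andP; split; lra.
Qed.

Section distance_to_set.
Context {R : realType} {X : pmetricType R} (C : set X).
Hypothesis C0 : C !=set0.

Definition set_dist (x : X) : R := inf [set mdist x y | y in C].

Let has_inf_dist x : has_inf [set mdist x y | y in C].
Proof.
split; first by have [y Cy] := C0; exists (mdist x y), y.
by exists 0 => _ [y _ <-]; exact: mdist_ge0.
Qed.

Lemma set_dist_ge0 x : 0 <= set_dist x.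
Proof.
apply: lb_le_inf; first by have [] := has_inf_dist x.
by move=> _ [y _ <-]; exact: mdist_ge0.
Qed.

Lemma set_dist_lipschitz x y : set_dist x - set_dist y <= mdist x y.
Proof.
rewrite lerBlDl -lerBlDr; apply: lb_le_inf; first by have [] := has_inf_dist y.
move=> _ [z Cz <-]; rewrite lerBlDl; apply: le_trans (metric_triangle _ _ _).
by apply: ge_inf; [have [] := has_inf_dist x|exists z].
Qed.

Lemma set_dist0 x : C x -> set_dist x = 0.
Proof.
move=> Cx; apply/le_anti; rewrite set_dist_ge0 andbT -(mdistxx x).
by apply: ge_inf; [have [] := has_inf_dist x|exists x].
Qed.

Lemma set_dist_gt0 x : closed C -> ~ C x -> 0 < set_dist x.
Proof.
move=> cC nCx.
have /nbhs_mdist[e e0 eC] : nbhs x (~` C).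
  by apply: open_nbhs_nbhs; split => //; exact: closed_openC.
apply: (lt_le_trans e0); apply: lb_le_inf; first by have [] := has_inf_dist x.
by move=> _ [z Cz <-]; rewrite leNgt; apply/negP => /eC.
Qed.

End distance_to_set.

Section uniqueness.
Context {R : realType} {X : pmetricType R}.

(** Truncated multiples of the distance to the complement. *)
Lemma open_approximation (U : set X) : open U ->
  exists f : nat -> X -> R, [/\ forall n, continuous (f n),
    forall n x, 0 <= f n x <= 1 & forall x, f n x @[n --> \oo] --> (\1_U x : R)].
Proof.
move=> oU; have [C0|/set0P/negP] := pselect (~` U !=set0); last first.
  rewrite negbK => /eqP UT; exists (fun _ _ => 1); split => [n x|n x|x].
  - exact: cvg_cst.
  - by rewrite ler01 lexx.
  - have Ux : U x by apply: contrapT => nUx; have : (~` U) x by []; rewrite UT.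
    by rewrite indicE mem_set//; exact: cvg_cst.
exists (fun n x => Num.min 1 (n%:R * set_dist (~` U) x)); split.
- move=> n; apply: (@lipschitz_continuous _ _ _ n%:R) => x y.
  have h := set_dist_lipschitz C0 x y.
  have h' : n%:R * set_dist (~` U) x <= n%:R * set_dist (~` U) y + n%:R * mdist x y.
    by rewrite -mulrDr ler_wpM2l//; lra.
  have h'' : 0 <= n%:R * mdist x y by rewrite mulr_ge0 ?mdist_ge0.
  rewrite lerBlDl; case: (lerP 1 (n%:R * set_dist (~` U) y)) => hy.
    by rewrite ge_min; apply/orP; left; lra.
  by rewrite ge_min; apply/orP; right; lra.
- move=> n x; rewrite le_min ler01 ge_min lexx /= andbT.
  by rewrite mulr_ge0// set_dist_ge0.
- move=> x; rewrite indicE; have [xU|xU] := boolP (x \in U); last first.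
    rewrite set_dist0 //; last by move=> /mem_set; rewrite (negbTE xU).
    by rewrite (_ : (fun n => _) = cst 0); [exact: cvg_cst|apply/funext => n; rewrite mulr0 min_r].
  have dx : 0 < set_dist (~` U) x.
    apply: set_dist_gt0 => //; first exact: open_closedC.
    by move=> nU; apply: nU; exact: set_mem.
  apply: cvg_near_cst; near=> n; rewrite min_l// -ler_pdivrMr//.
  by near: n; exact: nbhs_infty_ger.
Unshelve. all: by end_near. Qed.

(** Continuous functions determine the measure of open sets, which form a
    pi-system generating the Borel sets. *)
Lemma probability_eq (nu1 nu2 : probability (borel X) R) :
  compact [set: X] ->
  (forall f : X -> R, continuous f ->
    (\int[nu1]_x (f x)%:E = \int[nu2]_x (f x)%:E)%E) ->
  forall A, measurable A -> nu1 A = nu2 A.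
Proof.
move=> cX fE.
have lim_open (nu : probability (borel X) R) (U : set X) (f : nat -> X -> R) :
    open U -> (forall n, continuous (f n)) -> (forall n x, 0 <= f n x <= 1) ->
    (forall x, f n x @[n --> \oo] --> (\1_U x : R)) ->
    (\int[nu]_x (f n x)%:E)%E @[n --> \oo] --> nu U.
  move=> oU fc f01 fU; have mU := measurable_open oU.
  have [] := @dominated_convergence _ (borel X) R nu setT measurableT
    (fun n x => (f n x)%:E) (fun x => (\1_U x)%:E) (fun=> 1%:E).
  - move=> n; apply/measurable_EFinP. exact: continuous_measurable_real.
  - exact/measurable_EFinP/measurable_indic.
  - by apply: aeW => x _; apply: cvg_EFin; [exact: nearW|exact: fU].
  - exact: finite_measure_integrable_cst.
  - by apply: aeW => x n _; have /andP[h0 h1] := f01 n x; rewrite /= lee_fin ger0_norm.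
  - by move=> _ _; rewrite integral_indic// setIT.
apply: (@measure_unique _ _ _ (@open X : set (set (borel X))) (fun=> setT)) => //.
- by move=> U V; exact: openI.
- by move=> _; exact: openT.
- by rewrite bigcup_const//; exists 0%N.
- move=> U oU; have [f [fc f01 fU]] := open_approximation oU.
  have h1 := lim_open nu1 U f oU fc f01 fU; have h2 := lim_open nu2 U f oU fc f01 fU.
  have fE' : (fun n => (\int[nu1]_x (f n x)%:E)%E) = fun n => (\int[nu2]_x (f n x)%:E)%E.
    by apply/funext => n; exact: fE.
  rewrite fE' in h1.
  exact: (cvg_unique (@ereal_hausdorff R) h1 h2).
- by move=> k; apply: (@le_lt_trans _ _ 1%E); [exact: probability_le1|exact: ltry].
Qed.

End uniqueness.

Lemma weak_star_mean (R : realType) (X : ptopologicalType) (T : X -> X) (x : X)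
    (N : nat -> nat) (nu : probability (borel X) R) (f : X -> R) :
  compact [set: X] -> weak_star_cvg (fun k => empirical T x (N k)) nu ->
  continuous f ->
  mean_upto (fun n => f (iter n T x)) (N k) @[k --> \oo] --> (\int[nu]_y f y)%R.
Proof.
move=> cX nuE cf.
have fi := continuous_integrable nu cX cf.
have := nuE _ cf; rewrite -[X in _ --> X](fineK (integrable_fin_num _ fi))//.
move=> /fine_cvg; rewrite (_ : fine \o _ = fun k => mean_upto (fun n => f (iter n T x)) (N k))//.
by apply/funext => k /=; rewrite integral_empirical.
Qed.

Section identity.
Context {R : realType} {X : pmetricType R}.

Lemma continuous_iter (T : X -> X) n : continuous T -> continuous (iter n T).
Proof.
move=> cT; elim: n => [|n IH] x; first exact: cvg_id.
by apply: (@continuous_comp _ _ _ (iter n T) T); [exact: IH|exact: cT].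
Qed.

Lemma mean_upto_shift_cvg (a : nat -> R) (M : R) (N : nat -> nat) :
  (forall n, `|a n| <= M) -> N k @[k --> \oo] --> \oo ->
  (mean_upto (fun n => a n.+1) (N k) - mean_upto a (N k)) @[k --> \oo] --> 0.
Proof.
move=> aM Noo.
suff : (mean_upto (fun n => a n.+1) n - mean_upto a n) @[n --> \oo] --> 0.
  by move=> h; apply: cvg_comp Noo h.
apply: (@squeeze_cvgr _ _ _ _ (fun n => - (n%:R^-1 * (M + M))) (fun n => n%:R^-1 * (M + M))).
- apply: nearW => n; rewrite -ler_norml.
  have -> : mean_upto (fun j => a j.+1) n = mean_upto (fun j => a (j + 1)%N) n.
    by apply: eq_mean_upto => j _; rewrite addn1.
  by rewrite -[leRHS]mulr1n; apply: mean_upto_shift_bound => j _; exact: aM.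
- rewrite -[X in _ --> X]oppr0; apply: cvgN; rewrite -[X in _ --> X](mul0r (M + M)).
  by apply: cvgM; [exact: cvg_invn|exact: cvg_cst].
- rewrite -[X in _ --> X](mul0r (M + M)).
  by apply: cvgM; [exact: cvg_invn|exact: cvg_cst].
Qed.

(** Krylov-Bogoliubov: averages along [x] and along [T x] have the same limit. *)
Lemma limit_invariant (T : X -> X) (x : X) (N : nat -> nat)
    (nu : probability (borel X) R) :
  compact [set: X] -> continuous T -> increasing_positive N ->
  weak_star_cvg (fun k => empirical T x (N k)) nu ->
  invariant_measure (T : borel X -> borel X) nu.
Proof.
move=> cX cT [_ Ninc] nuE A mA.
pose Tm : {mfun borel X >-> borel X} :=
  HB.pack (T : borel X -> borel X)
   (isMeasurableFun.Build _ _ _ _ _ (measurable_continuous cT)).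
apply: (@probability_eq _ _ (distribution nu Tm) nu cX _ A mA) => f cf.
have cfT : continuous (f \o T) by move=> y; exact: continuous_comp (cT y) (cf _).
have ifT := continuous_integrable nu cX cfT.
rewrite integral_pushforward//; last first.
  by apply/measurable_EFinP; exact: continuous_measurable_real cf.
rewrite preimage_setT.
have fi := continuous_integrable nu cX cf.
rewrite -[LHS](fineK (integrable_fin_num _ ifT))// -[RHS](fineK (integrable_fin_num _ fi))//.
congr _%:E.
have h1 := weak_star_mean cX nuE cfT; have h2 := weak_star_mean cX nuE cf.
have [M _ fM] := continuous_bound cX cf.
have h3 := mean_upto_shift_cvg (fun n => fM (iter n T x)) (increasing_cvg Ninc).
apply/eqP; rewrite -subr_eq0; apply/eqP.
exact: (cvg_unique (@norm_hausdorff _ _) (cvgB h1 h2) h3).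
Qed.

(** An isomorphism [phi] with an identity map satisfies [phi (T x) = phi x] on a
    [T]-stable set of full measure where it is injective. *)
Lemma identity_ae (T : X -> X) (nu : probability (borel X) R) :
  class_ID T -> visible T nu ->
  exists X0 : set (borel X), [/\ measurable X0, nu X0 = 1%E
    & forall x h, X0 x -> iter h T x = x].
Proof.
move=> [_ h] /h[d [Y [kappa [_ [X0 [Y0 [phi [[mX0 nu1 TX0] _ [[_ inj _] _ _] _ phiT]]]]]]]].
exists X0; split => // x n X0x; elim: n => //= n ->.
by apply: inj; rewrite ?inE //; [apply: TX0; exists x|exact: phiT].
Qed.

(** The function [y |-> cabs (f (T^h y) - f y)] is continuous and vanishes almost
    everywhere for the limit measure. *)
Lemma orbit_almost_constant (T : X -> X) (x : X) (N : nat -> nat)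
    (nu : probability (borel X) R) (f : X -> R[i]) h :
  class_ID T -> visible T nu ->
  weak_star_cvg (fun k => empirical T x (N k)) nu -> continuous f ->
  mean_upto (fun n => cabs (f (iter (n + h) T x) - f (iter n T x))) (N k)
    @[k --> \oo] --> 0.
Proof.
move=> TID vnu nuE cf.
have [X0 [mX0 nuX0 X0h]] := identity_ae TID vnu.
have [[cX [cT _]] _] := TID.
pose psi y := cabs (f (iter h T y) - f y).
have cpsi : continuous psi.
  move=> y; apply: (@continuous_comp _ _ _
    (fun y => f (iter h T y) - f y) cabs); last exact: cabs_continuous.
  apply: cvgB; last exact: cf.
  by apply: (@continuous_comp _ _ _ (iter h T) f); [exact: continuous_iter|exact: cf].
have := weak_star_mean cX nuE cpsi.
have -> : (\int[nu]_y psi y)%R = 0.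
  rewrite /Rintegral (ae_eq_integral (cst 0%E)) ?integral0//.
    by apply/measurable_EFinP; exact: continuous_measurable_real cpsi.
  have nuC : nu (~` X0) = 0%E by rewrite probability_setC// nuX0 subee.
  exists (~` X0); split => //; first exact: measurableC.
  move=> y /= h0 X0y; apply: h0 => _.
  by rewrite /psi X0h// subrr cabs0.
rewrite (_ : (fun k => _) = fun k =>
  mean_upto (fun n => cabs (f (iter (n + h) T x) - f (iter n T x))) (N k))//.
by apply/funext => k; apply: eq_mean_upto => n _; rewrite /psi addnC iterD.
Qed.

End identity.

(** * Small short averages imply orthogonality *)

Section almost_constant.
Context {R : realType}.

Lemma cabs_mean_upto (a : nat -> R[i]) N :
  cabs (mean_upto a N) <= mean_upto (fun n => cabs (a n)) N.
Proof.
rewrite /mean_upto cabsM (_ : N%:R^-1 = (N%:R^-1 : R)%:C); last by rewrite fmorphV rmorph_nat.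
rewrite cabs_real ger0_norm ?invr_ge0// ler_wpM2l ?invr_ge0//.
exact: cabs_sum.
Qed.

(** As [a] is almost invariant under shifts, [u n] can be replaced by its short
    average over [n + 1, ..., n + H], which is small in quadratic mean. *)
Lemma almost_constant_orthogonal (a u : nat -> R[i]) (M L : R) (N : nat -> nat) :
  (forall n, cabs (a n) <= M) -> (forall n, (0 < n)%N -> cabs (u n) <= L) ->
  N k @[k --> \oo] --> \oo ->
  (forall h, mean_upto (fun n => cabs (a (n + h)%N - a n)) (N k) @[k --> \oo] --> 0) ->
  (forall e, 0 < e -> exists2 H, (0 < H)%N & \forall k \near \oo,
     mean_upto (fun n => cabs (mean_upto (fun h => u (n + h)%N) H) ^+ 2) (N k) <= e) ->
  mean_upto (fun n => a n * u n) (N k) @[k --> \oo] --> (0 : R[i]).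
Proof.
move=> aM uL Noo aconst ushort.
have M0 : 0 <= M by apply: le_trans (aM 0%N); exact: cabs_ge0.
have L0 : 0 <= L by apply: le_trans (uL 1%N _); rewrite ?cabs_ge0.
pose E h k := L * mean_upto (fun n => cabs (a (n + h)%N - a n)) (N k)
  + (N k)%:R^-1 * (M * L + M * L) *+ h.
have E0 h : E h k @[k --> \oo] --> 0.
  rewrite -[X in _ --> X]addr0 -[X in _ --> X + _](mulr0 L).
  apply: cvgD; first by apply: cvgM; [exact: cvg_cst|exact: aconst].
  rewrite -[X in _ --> X](mulr0 ((M * L + M * L) *+ h)).
  under eq_fun do rewrite -mulrnAr mulrC.
  by apply: cvgM; [exact: cvg_cst|exact: (cvg_comp N (fun n => n%:R^-1 : R) Noo (@cvg_invn R))].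
have EP h k : cabs (mean_upto (fun n => a n * u n) (N k) -
    mean_upto (fun n => a n * u (n + h)%N) (N k)) <= E h k.
  pose b n := a n * u n.
  rewrite -(subrKA (mean_upto (fun n => b (n + h)%N) (N k))) addrC.
  apply: le_trans (cabsD _ _) _; apply: lerD.
    rewrite mean_uptoB; apply: le_trans (cabs_mean_upto _ _) _.
    rewrite (_ : L * _ = mean_upto (fun n => L * cabs (a (n + h)%N - a n)) (N k)); last first.
      by rewrite /mean_upto -mulr_sumr mulrCA.
    apply: ler_mean_upto => n /andP[n0 _].
    rewrite -mulrBl cabsM mulrC ler_wpM2r ?cabs_ge0// uL// addn_gt0 n0//.
  rewrite cabs_distC -ler_cabs.
  have bM n : (0 < n)%N -> `|b n| <= (M * L)%:C.
    move=> n0; rewrite ler_cabs cabsM ler_pM ?cabs_ge0//; exact: uL.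
  apply: le_trans (mean_upto_shift_bound _ h bM) _.
  by move: (M * L) => c; rewrite rmorphMn rmorphM rmorphD fmorphV rmorph_nat.
apply/cvg_cabsP => e e0.
(* The average of [a n * B n] will be at most [M * s <= e / 4]. *)
pose s := e / (4 * (M + 1)).
have M1 : 0 < M + 1 by rewrite ltr_wpDl.
have s0 : 0 < s by rewrite divr_gt0// mulr_gt0.
have [//|H H0 short] := ushort (s ^+ 2); first by rewrite exprn_gt0.
near=> k.
rewrite sub0r cabsN.
pose B n := mean_upto (fun h => u (n + h)%N) H.
have h1 : cabs (mean_upto (fun n => a n * B n) (N k)) <= M * s.
  apply: le_trans (cabs_mean_upto _ _) _.
  (* From [2 * b <= b ^+ 2 / s + s]; the choice of [s] balances the two terms. *)
  have -> : M * s = M * ((s^-1 * s ^+ 2 + s) / 2) by field; rewrite gt_eqF.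
  apply: (@le_trans _ _ (M * ((s^-1 * mean_upto (fun n => cabs (B n) ^+ 2) (N k) + s) / 2))).
    apply: (@le_trans _ _ (mean_upto (fun n => M * ((s^-1 * cabs (B n) ^+ 2 + s) / 2)) (N k))).
      apply: ler_mean_upto => n _; rewrite cabsM ler_pM ?cabs_ge0//.
      rewrite ler_pdivlMr// -subr_ge0.
      rewrite (_ : _ - _ = s^-1 * (cabs (B n) - s) ^+ 2); last by field; rewrite gt_eqF.
      by rewrite mulr_ge0 ?sqr_ge0// invr_ge0 ltW.
    rewrite le_eqVlt; apply/orP; left; apply/eqP.
    set t := s^-1; rewrite -[in RHS](@mean_upto_cst _ s (N k)); last first.
      by near: k; exact: (Noo _ (nbhs_infty_gt 0)).
    rewrite /mean_upto; under eq_bigr do rewrite mulrA.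
    rewrite -mulr_suml -mulr_sumr big_split/= -mulr_sumr; ring.
  rewrite ler_wpM2l// ler_wpM2r// lerD2r ler_wpM2l ?invr_ge0 ?(ltW s0)//.
  by near: k.
have h2 : cabs (mean_upto (fun n => a n * u n) (N k) -
    mean_upto (fun n => a n * B n) (N k)) <= e / 2.
  have -> : mean_upto (fun n => a n * B n) (N k) =
      mean_upto (fun h => mean_upto (fun n => a n * u (n + h)%N) (N k)) H.
    rewrite -mean_upto_exchange; apply: eq_mean_upto => n _.
    by rewrite /B /mean_upto -mulr_sumr mulrCA.
  rewrite -[X in cabs (X - _)](@mean_upto_cst _ _ H)// mean_uptoB.
  apply: le_trans (cabs_mean_upto _ _) _.
  rewrite -[leRHS](@mean_upto_cst _ _ H)//; apply: ler_mean_upto => h /andP[_ hH].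
  apply: le_trans (EP h k) _.
  have : forall i : 'I_H.+1, E i k <= e / 2.
    near: k; apply: filter_forall => i.
    have := E0 i => /cvgrPdist_le /(_ (e / 2)); rewrite divr_gt0// => /(_ isT).
    by apply: filterS => k; rewrite sub0r normrN => /(le_trans (ler_norm _)).
  by move=> /(_ (Ordinal (hH : (h < H.+1)%N))).
rewrite -(subrK (mean_upto (fun n => a n * B n) (N k)) (mean_upto _ _)).
apply: le_lt_trans (cabsD _ _) _.
have : M * s <= e / 4.
  rewrite /s mulrA ler_pdivrMr ?mulr_gt0// (_ : e / 4 * (4 * (M + 1)) = e * (M + 1)); last by field.
  by rewrite mulrDr mulr1 mulrC lerDl ltW.
lra.
Unshelve. all: by end_near. Qed.
End almost_constant.

Lemma frequently_subsequence (P : nat -> Prop) :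
  (forall m, exists2 n, (m < n)%N & P n) ->
  exists2 N : nat -> nat, increasing_positive N & forall k, P (N k).
Proof.
move=> h; have /choice[g gP] : forall m, exists n, (m < n)%N /\ P n.
  by move=> m; have [n mn Pn] := h m; exists n.
pose N k := iter k g (g 0%N).
exists N; last by case=> [|k]; [case: (gP 0%N)|case: (gP (iter k g (g 0%N)))].
split; first by have [] := gP 0%N.
by apply: increasing_of_step => k; rewrite /N iterS; have [] := gP (iter k g (g 0%N)).
Qed.

Lemma not_cvg0_subsequence (R : realType) (a : nat -> R[i]) :
  ~ (a n @[n --> \oo] --> (0 : R[i])) ->
  exists2 e : R, 0 < e & exists2 N : nat -> nat, increasing_positive N &
    forall k, e <= cabs (a (N k)).
Proof.
move=> na; apply: contrapT => h; apply: na; apply/cvg_cabsP => e e0.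
apply: contrapT => ne; apply: h; exists e => //.
apply: (@frequently_subsequence (fun n => e <= cabs (a n))) => m; apply: contrapT => hm; apply: ne.
exists m.+1 => // n /= mn; rewrite sub0r cabsN ltNge; apply/negP => en.
by apply: hm; exists n.
Qed.

Lemma increasing_positive_comp (N phi : nat -> nat) :
  increasing_positive N -> {homo phi : k l / (k < l)%N >-> (k < l)%N} ->
  increasing_positive (fun k => N (phi k)).
Proof.
move=> [N0 Ninc] phi_inc; split; last by move=> k l /phi_inc/Ninc.
by case: (phi 0%N) => [//|j]; apply: leq_ltn_trans (Ninc 0%N j.+1 _).
Qed.

Lemma weak_star_cvg_subsequence (R : realType) (X : ptopologicalType)
    (mu : nat -> {measure set (borel X) -> \bar R}) nu (phi : nat -> nat) :
  {homo phi : k l / (k < l)%N >-> (k < l)%N} ->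
  weak_star_cvg mu nu -> weak_star_cvg (fun k => mu (phi k)) nu.
Proof.
move=> phi_inc muE f cf.
exact: (cvg_comp phi (fun k => \int[mu k]_x (f x)%:E)%E (increasing_cvg phi_inc) (muE f cf)).
Qed.

Section sufficiency.
Context {R : realType} (L : {nonneg R}) (u : nat -> R[i]) (u0 : R[i]).
Hypotheses (uL : forall n : nat, (0 < n)%N -> `|u n| <= (L%:num)%:C)
  (u0L : `|u0| <= (L%:num)%:C).

(** Two extractions, one in [X] and one in the shift space, make [T] the identity
    for the limit measure and give a sequence defining a Furstenberg system. *)
Lemma short_averages_orthogonal :
  (forall eps : R, 0 < eps ->
   forall N : nat -> nat, defines_furstenberg_system (extension uL u0L) N ->
   exists H0 : nat, (1 <= H0)%N /\
     forall H : nat, (H0 <= H)%N ->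
     exists2 l : R,
       mean_upto (fun n : nat =>
         complex.Re `|mean_upto (fun h : nat => u (n + h)%N) H| ^+ 2) (N k)
         @[k --> \oo] --> l
       & l <= eps) ->
  orthogonal_class_ID u.
Proof.
move=> short X T TID f x cf; apply: contrapT => /not_cvg0_subsequence[e e0 [N Npos Ne]].
have [[cX [cT _]] _] := TID.
have [g cg gs] := compact_metric_cantor cX.
have [phi [nu [phi_inc nuE]]] := @empirical_subsequence R X g T x N cg gs Npos.
have N1pos := increasing_positive_comp Npos phi_inc.
have vnu : visible T nu.
  split; first exact: (limit_invariant cX cT N1pos nuE).
  by exists x, (fun k => N (phi k)).
have [g' cg' gs'] := @shift_space_cantor R L.
have [psi [kappa [psi_inc kappaE]]] :=
  @empirical_subsequence R _ g' (@left_shift R L) (extension uL u0L) _ cg' gs' N1pos.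
have N2pos := increasing_positive_comp N1pos psi_inc.
have furst : defines_furstenberg_system (extension uL u0L) (fun k => N (phi (psi k))).
  by split => //; exists kappa.
have nuE2 := weak_star_cvg_subsequence psi_inc nuE.
have cabsf : continuous (fun y => cabs (f y)).
  by move=> y; apply: (@continuous_comp _ _ _ f cabs); [exact: cf|exact: cabs_continuous].
have [M _ fM] := continuous_bound cX cabsf.
suff /cvg_cabsP/(_ e e0)[K _ hK] : mean_upto (fun n => f (iter n T x) * u n)
    (N (phi (psi k))) @[k --> \oo] --> (0 : R[i]).
  by have := hK K (leqnn K); rewrite sub0r cabsN ltNge Ne.
apply: (@almost_constant_orthogonal R (fun n => f (iter n T x)) u M L%:num
  (fun k => N (phi (psi k)))).
- by move=> n; have := fM (iter n T x); rewrite ger0_norm ?cabs_ge0.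
- by move=> n n0; rewrite -ler_cabs; exact: uL.
- by apply: increasing_cvg; case: N2pos.
- by move=> h; exact: (orbit_almost_constant h TID vnu nuE2 cf).
- move=> eps eps0; have e2 : 0 < eps / 2 by rewrite divr_gt0.
  have [H [H0 /(_ H (leqnn H))[l lE le]]] := short _ e2 _ furst.
  exists H => //.
  have l_lt : l < eps by apply: (le_lt_trans le); lra.
  exact: (cvgr_le l lE eps l_lt).
Qed.
End sufficiency.

(** * A system of the class containing a slowly varying sequence *)

(** The integers stand for the orbit of the sequence [a], the disc for its
    possible limit values; the parameter [a] selects the metric. *)
Definition slow_space (R : realType) (L : {nonneg R}) (a : int -> closed_disc L) : Type :=
  (int + closed_disc L)%type.

Section slow_space.
Context {R : realType} {L : {nonneg R}} (a : int -> closed_disc L).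

HB.instance Definition _ := Choice.on (slow_space a).

Definition fiber (p : slow_space a) : closed_disc L :=
  match p with inl n => a n | inr z => z end.

Definition height (p : slow_space a) : R :=
  match p with inl n => `|n|%N.+1%:R^-1 | inr _ => 0 end.

(** The points of the orbit are isolated, and they approach the disc when the
    index tends to infinity. Adding the two heights of distinct points, instead
    of taking their difference, makes the triangle inequality immediate. *)
Definition slow_dist (p q : slow_space a) : R :=
  if p == q then 0
  else height p + height q + cabs (disc_val (fiber p) - disc_val (fiber q)).

Lemma height_ge0 p : 0 <= height p.
Proof. by case: p => [n|z] //=; rewrite invr_ge0. Qed.

Lemma slow_distxx p : slow_dist p p = 0.
Proof. by rewrite /slow_dist eqxx. Qed.

Lemma slow_dist_positivity p q : slow_dist p q = 0 -> p = q.
Proof.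
rewrite /slow_dist; case: eqP => // _ /eqP.
have c0 := cabs_ge0 (disc_val (fiber p) - disc_val (fiber q)).
rewrite paddr_eq0 ?addr_ge0 ?height_ge0// paddr_eq0 ?height_ge0//.
move=> /andP[/andP[]]; case: p c0 => [n|z] _ /=; first by rewrite invr_eq0 pnatr_eq0.
case: q => [n|w] /= _; first by rewrite invr_eq0 pnatr_eq0.
by move=> _ /eqP/cabs_eq0/eqP; rewrite subr_eq0 => /eqP h; congr inr; exact: val_inj.
Qed.

Lemma slow_dist_sym p q : slow_dist p q = slow_dist q p.
Proof.
by rewrite /slow_dist eq_sym; case: ifP => // _; rewrite cabs_distC (addrC (height p)).
Qed.

Lemma slow_dist_triangle q p r : slow_dist p r <= slow_dist p q + slow_dist q r.
Proof.
have hp := height_ge0 p; have hq := height_ge0 q; have hr := height_ge0 r.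
have := cabsD (disc_val (fiber p) - disc_val (fiber q))
  (disc_val (fiber q) - disc_val (fiber r)).
rewrite subrKA => tri.
have h1 := cabs_ge0 (disc_val (fiber p) - disc_val (fiber q)).
have h2 := cabs_ge0 (disc_val (fiber q) - disc_val (fiber r)).
rewrite /slow_dist; case: (eqVneq p r) => [_|pr].
  by do 2 case: ifP => _; lra.
case: (eqVneq p q) pr => [->|pq] pr; first by rewrite (negbTE pr) add0r.
case: (eqVneq q r) => [<-|qr]; first by rewrite addr0.
by lra.
Qed.

HB.instance Definition _ := isMetric.Build R (slow_space a) slow_distxx
  slow_dist_positivity slow_dist_sym slow_dist_triangle.

HB.instance Definition _ := isPointed.Build (slow_space a) (inr point).

Lemma slow_mdistE (p q : slow_space a) : mdist p q = slow_dist p q.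
Proof. by []. Qed.

Lemma fiber_dist (p q : slow_space a) :
  cabs (disc_val (fiber p) - disc_val (fiber q)) <= slow_dist p q.
Proof.
rewrite /slow_dist; case: eqP => [->|_]; first by rewrite subrr cabs0.
by rewrite lerDr addr_ge0// height_ge0.
Qed.

Lemma fiber_continuous : continuous (fun p : slow_space a => disc_val (fiber p)).
Proof.
move=> p; apply/(@cvg_cabsP _ _ (nbhs p) (nbhs_filter p)) => e e0.
apply/nbhs_mdist; exists e => // q; exact: le_lt_trans (fiber_dist p q).
Qed.

Lemma nbhs_inl n (P : set (slow_space a)) : P (inl n) -> nbhs (inl n : slow_space a) P.
Proof.
move=> Pn; apply/nbhs_mdist; exists (height (inl n)).
  by rewrite /= invr_gt0.
move=> q; rewrite slow_mdistE /slow_dist; case: eqP => [<-//|_].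
rewrite ltNge -addrA lerDl addr_ge0 ?height_ge0//; exact: cabs_ge0.
Qed.

Definition translate (s : int) (p : slow_space a) : slow_space a :=
  match p with inl n => inl (n + s) | inr z => inr z end.

Lemma height_translate s p : (`|s| <= 1)%N -> height (translate s p) <= 2 * height p.
Proof.
case: p => [n|z] s1 /=; last by rewrite mulr0.
rewrite -[leLHS]mul1r ler_pdivrMr// mulrAC ler_pdivlMr// mul1r -natrM ler_nat; lia.
Qed.

(** Isolated points raise no issue. Near a point of the disc, translation moves
    the observed value by [a (n + s) - a n], which is small since [n] is large. *)
Lemma translate_continuous s : (`|s| <= 1)%N ->
  (forall e, 0 < e -> exists K, forall n : int, (K <= `|n|)%N ->
     cabs (disc_val (a (n + s)) - disc_val (a n)) < e) ->
  continuous (translate s).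
Proof.
move=> s1 slow [n|z]; first by move=> P /= /nbhs_singleton Pn; exact: nbhs_inl.
move=> P /nbhs_mdist[e e0 eP]; apply/nbhs_mdist => /=.
have e2 : 0 < e / 4 by rewrite divr_gt0.
have [K KP] := slow _ e2.
exists (Num.min (e / 4) K.+1%:R^-1); first by rewrite lt_min e2 invr_gt0 ltr0n.
move=> q; rewrite slow_mdistE lt_min => /andP[zq zq'].
apply: eP; rewrite slow_mdistE; case: q zq zq' => [n|w] /=; last first.
  by move=> wz _; apply: (lt_le_trans wz); lra.
rewrite /slow_dist /= !add0r => h1 h2.
have hn : (K <= `|n|)%N.
  have : `|n|%N.+1%:R^-1 < (K.+1%:R^-1 : R).
    by apply: le_lt_trans h2; rewrite lerDl cabs_ge0.
  by rewrite ltf_pV2 ?posrE ?ltr0n// ltr_nat ltnS => /ltnW.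
have := KP n hn; rewrite cabs_distC => h3.
have h4 := @height_translate s (inl n) s1.
have h5 := cabsD (disc_val z - disc_val (a n)) (disc_val (a n) - disc_val (a (n + s))).
rewrite subrKA in h5; move: h4; rewrite /= => h4.
have h6 := cabs_ge0 (disc_val z - disc_val (a n)).
have h7 : (0 : R) <= `|n|%N.+1%:R^-1 by rewrite invr_ge0.
move: ((absz n).+1%:R^-1 : R) ((absz (n + s)%R).+1%:R^-1 : R) h1 h4 h7 => x y h1 h4 h7.
lra.
Qed.

Lemma translateK s : cancel (translate s) (translate (- s)).
Proof. by case=> [n|z] //=; rewrite addrK. Qed.

Lemma iter_translate n m : iter n (translate 1) (inl m) = inl (m + n%:Z).
Proof. by elim: n => [|n IH] /=; rewrite ?addr0// IH /= -addrA [_ + 1]addrC -intS. Qed.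

Lemma closed_disc_compact : compact [set: closed_disc L].
Proof.
by have [g cg gs] := @closed_disc_cantor R L; exact: cantor_image_compact cg gs.
Qed.

(** An ultrafilter either contains a finite set, or its heights tend to [0] and
    it converges to the limit in the disc of the values of [fiber]. *)
Lemma slow_space_compact : compact [set: slow_space a].
Proof.
rewrite compact_ultra => U uU _.
have pU : ProperFilter U := @ultra_proper _ _ uU.
have [low|] := pselect (forall e, 0 < e -> U [set p | height p < e]); last first.
  move=> /existsNP[e /not_implyP[e0 nU]].
  have [//|high] := @in_ultra_setVsetC _ _ [set p | height p < e] uU.
  have /finite_compact : finite_set (~` [set p : slow_space a | height p < e]).
    have [K Ke] : exists K, forall n : int, (K <= `|n|)%N -> (`|n|%N.+1%:R^-1 : R) < e.
      have [K _ hK] := near_infty_natSinv_lt (PosNum e0).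
      by exists K => n /hK.
    apply: (@sub_finite_set _ _ ((fun k : nat => inl (Posz k)) @` `I_K `|`
       (fun k : nat => inl (Negz k)) @` `I_K)).
      case=> [n|z] /=; last by rewrite e0.
      move=> hn; have {}hn : (`|n| < K)%N by rewrite ltnNge; apply/negP => /Ke.
      case: n hn => n hn; [left|right]; exists n => //=.
      exact: ltn_trans (ltnSn n) hn.
    by rewrite finite_setU; split; apply: finite_image; exact: finite_II.
  by rewrite compact_ultra => /(_ U uU high)[p [_ Up]]; exists p.
have cF : (fiber @ U) [set: closed_disc L] by exact: filterT.
have [z [_ clz]] := closed_disc_compact _ cF.
exists (inr z); split => //= P /nbhs_mdist[e e0 eP].
have e2 : 0 < e / 2 by rewrite divr_gt0.
have Uz : U [set p | cabs (disc_val z - disc_val (fiber p)) < e / 2].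
  have [//|nU] := @in_ultra_setVsetC _ _
    [set p | cabs (disc_val z - disc_val (fiber p)) < e / 2] uU.
  have nz : nbhs z [set w | cabs (disc_val z - disc_val w) < e / 2].
    exact: ((@cvg_cabsP _ _ (nbhs z) (nbhs_filter z) (@disc_val _ L) (disc_val z)).1
      (@disc_val_continuous _ L z) _ e2).
  have [w [/= h1 h2]] := clz [set w | ~ (cabs (disc_val z - disc_val w) < e / 2)] _ nU nz.
  by [].
apply: filterS (filterI Uz (low _ e2)) => p [/= h1 h2]; apply: eP.
rewrite slow_mdistE /slow_dist; case: ifP => // _ /=; rewrite add0r.
by rewrite (splitr e) ltrD.
Qed.

Lemma slow_space_polish : polish ((slow_space a) : pmetricType R).
Proof.
split=> [F FF cF|].
  apply: (@compact_cauchy_cvg (slow_space a) setT) => //; first exact: filterT.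
  exact: slow_space_compact.
have [B cB [Bo Bb]] := compact_second_countable slow_space_compact.
exists ((fun V : set (slow_space a) => xget point V) @` B);
  first exact: card_le_trans (card_image_le _ _) cB.
move=> O [p Op] oO.
have [V [BV Vp] VO] := Bb p O (open_nbhs_nbhs (conj oO Op)).
have Vx := xgetPex point (ex_intro _ p Vp : exists x, V x).
by exists (xget point V); split; [exact: VO|exists V].
Qed.

(** The points of the orbit all have the same mass, and there are infinitely
    many of them. *)
Lemma invariant_inl0 (nu : probability (borel (slow_space a)) R) n :
  invariant_measure (translate 1 : borel (slow_space a) -> borel (slow_space a)) nu ->
  nu [set inl n] = 0%E.
Proof.
move=> inv.
have mpt m : measurable ([set inl m] : set (borel (slow_space a))).
  apply: (@measurable_open (slow_space a)).
  by rewrite openE => _ /= ->; exact: nbhs_inl.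
have eqm (k : nat) : nu [set inl (n + k%:Z)] = nu [set inl n].
  elim: k => [|k <-]; first by rewrite addr0.
  rewrite -(inv [set inl (n + k.+1%:Z)])//; congr (nu _).
  apply/seteqP; split => p /=.
    case: p => [m|z] //= [] h; congr inl.
    by apply: (addIr 1); rewrite h intS addrA addrAC.
  by move=> -> /=; rewrite -addrA [_ + 1]addrC -intS.
have sum_le (k : nat) : (fine (nu [set inl n]) *+ k <= 1)%R.
  have := @measure_bigsetU _ _ _ nu (fun i : nat => [set inl (n + i%:Z)]) _ _ k.
  have tr : trivIset setT (fun i : nat => [set (inl (n + i%:Z) : borel (slow_space a))]).
    by move=> i j _ _ [p [/= -> [/addrI[]]]].
  move=> /(_ (fun i => mpt _) tr).
  rewrite (eq_bigr (fun=> nu [set inl n])) => [|i _]; last exact: eqm.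
  have fin : nu [set inl n] \is a fin_num by exact: fin_num_measure.
  rewrite -(fineK fin) sumEFin sumr_const card_ord => h.
  by rewrite -lee_fin -h; apply: probability_le1; apply: bigsetU_measurable => i _; exact: mpt.
have fin : nu [set inl n] \is a fin_num by exact: fin_num_measure.
rewrite -(fineK fin); congr _%:E; apply/le_anti; rewrite fine_ge0 ?measure_ge0// andbT.
rewrite leNgt; apply/negP => c0.
pose k := (Num.bound (fine (nu [set inl n]))^-1).
have : (fine (nu [set inl n]))^-1 < k%:R.
  by apply: archi_boundP; rewrite invr_ge0 ltW.
rewrite -[ltLHS]mul1r ltr_pdivrMr// mulr_natl => h.
by have := sum_le k; rewrite leNgt h.
Qed.

(** Any invariant measure is carried by the disc, whose points are fixed. *)
Lemma slow_space_class_ID :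
  (forall e, 0 < e -> exists K, forall n : int, (K <= `|n|)%N ->
     cabs (disc_val (a (n + 1)) - disc_val (a n)) < e) ->
  class_ID (translate 1 : slow_space a -> slow_space a).
Proof.
move=> slow; split.
  split; first exact: slow_space_compact.
  split; first exact: translate_continuous.
  exists (translate (- 1)); split; last first.
  - by move=> p; rewrite -[in translate 1](opprK 1) translateK.
  - exact: translateK.
  apply: translate_continuous => // e /slow[K KP]; exists K.+1 => n Kn.
  by have := KP (n - 1); rewrite subrK cabs_distC; apply; lia.
move=> nu [inv _].
pose X0 : set (borel (slow_space a)) := ~` \bigcup_n [set inl n].
have mU : measurable (\bigcup_n [set inl n] : set (borel (slow_space a))).
  apply: (@measurable_open (slow_space a)); apply: bigcup_open => n _.
  by rewrite openE => _ /= ->; exact: nbhs_inl.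
have mX0 : measurable X0 by exact: measurableC.
have inX0 p : X0 p -> exists z, p = inr z.
  case: p => [n|z] h; last by exists z.
  by exfalso; apply: h; exists n.
have U0 : nu (\bigcup_n [set inl n]) = 0%E.
  apply/negligibleP => //.
  rewrite (_ : \bigcup_n _ =
    \bigcup_(k : nat) (if unpickle k is Some n then [set (inl n : borel (slow_space a))] else set0)).
    apply: negligible_bigcup => k; case: (unpickle k) => [n|]; last exact: negligible_set0.
    apply/negligibleP; last exact: invariant_inl0.
    apply: (@measurable_open (slow_space a)).
    by rewrite openE => _ /= ->; exact: nbhs_inl.
  apply/seteqP; split => p [n _].
    by move=> pn; exists (pickle n) => //; rewrite pickleK.
  by case: (unpickle n) => // m pm; exists m.
have nuX0 : nu X0 = 1%E by rewrite probability_setC// U0 sube0.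
have nuI B : measurable B -> nu (X0 `&` B) = nu B.
  move=> mB; rewrite [RHS](measureDI nu mB mX0) setIC.
  suff h : nu (B `\` X0) = 0%E by rewrite [X in (X + _)%E]h add0e.
  apply/eqP; rewrite eq_le measure_ge0 andbT -U0 le_measure ?inE//.
    exact: measurableD.
  by move=> p [_] /contrapT.
have fixX0 p : X0 p -> translate 1 p = p by move=> /inX0[z ->].
exists _, (borel (slow_space a)), nu; split.
  exists ((slow_space a) : pmetricType R), id, id; split => //.
  exact: slow_space_polish.
exists X0, X0, id; split.
- by split => // _ [p X0p <-]; rewrite fixX0.
- by split => // _ [p X0p <-].
- split; [|exact: measurable_id|by move=> A mA _; rewrite image_id].
  by split => // p; exists p.
- by move=> B mB; exact: nuI.
- by move=> p /fixX0.
Qed.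

End slow_space.

(** * Slowly growing window lengths *)

Section staircase.
Context {R : realType} (w : nat -> nat -> R) (bad : nat -> Prop) (delta C : R)
  (N : nat -> nat).
Hypotheses (delta0 : 0 < delta) (wC : forall H n, `|w H n| <= C).
Hypothesis N_cvg : N k @[k --> \oo] --> \oo.
Hypothesis bad_often : forall m, exists2 H, (m <= H)%N & bad H.
Hypothesis bad_mean : forall H, bad H ->
  \forall k \near \oo, 2 * delta <= mean_upto (w H) (N k).

(** The current window length and the sum of the [w (stair j) j] so far. The
    length [H] is increased as soon as it is not bad, or the average so far has
    reached [delta]. *)
Fixpoint stair_state (n : nat) : nat * R :=
  if n is n'.+1 then
    let: (H, s) := stair_state n' in
    let H' := if `[< ~ bad H \/ delta * n'%:R <= s >] then H.+1 else H in
    (H', s + w H' n)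
  else (1%N, 0).

Definition stair n := (stair_state n).1.

Let total n := (stair_state n).2.

Let totalE n : total n = \sum_(1 <= j < n.+1) w (stair j) j.
Proof.
elim: n => [|n IH]; first by rewrite big_geq.
rewrite big_nat_recr//= -IH /total /stair /=.
by case: (stair_state n).
Qed.

Let stairS n : stair n.+1 =
  if `[< ~ bad (stair n) \/ delta * n%:R <= total n >] then (stair n).+1 else stair n.
Proof. by rewrite /stair /total /=; case: (stair_state n). Qed.

Lemma stair_step n : stair n.+1 = stair n \/ stair n.+1 = (stair n).+1.
Proof. by rewrite stairS; case: ifP; [right|left]. Qed.

Lemma stair_mono m n : (m <= n)%N -> (stair m <= stair n)%N.
Proof.
move=> /subnKC <-; elim: (n - m)%N => [|k IH]; first by rewrite addn0.
by rewrite addnS; apply: leq_trans IH _; case: (stair_step (m + k)) => ->.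
Qed.

(** If the length stays at [H] for ever, then [H] is bad and the average has
    never reached [delta]; but the sums of [w (stair j) j] and of [w H j] stay at a
    bounded distance, and along [N] the average of the latter is eventually at
    least [2 * delta]. *)
Lemma stair_unbounded m : exists n, (m <= stair n)%N.
Proof.
elim: m => [|m [n0 mn0]]; first by exists 0%N.
apply: contrapT => /forallNP nex.
have stuck n : (n0 < n)%N -> stair n = stair n0.
  move=> n0n; apply/eqP; rewrite eqn_leq; apply/andP; split.
    by apply: leq_trans mn0; rewrite -ltnS ltnNge; apply/negP => /nex.
  exact: stair_mono (ltnW n0n).
have badH : bad (stair n0) /\ forall n, (n0 < n)%N -> total n < delta * n%:R.
  have notrig n : (n0 < n)%N -> ~ (~ bad (stair n0) \/ delta * n%:R <= total n).
    move=> n0n trig; have := stuck n.+1 (ltnW n0n); rewrite stairS stuck//.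
    by rewrite asboolT// => /esym/n_Sn.
  split; first by apply: contrapT => nb; apply: (notrig n0.+1); [exact: ltnSn|left].
  by move=> n n0n; rewrite ltNge; apply/negP => h; apply: (notrig n n0n); right.
case: badH => badH small.
have C0 : 0 <= C by apply: le_trans (wC 0 0).
suff : \forall k \near \oo, False by move=> /filter_ex[].
near=> k.
have n0N : (n0 < N k)%N by near: k; exact: (N_cvg (nbhs_infty_gt n0)).
have N0 : 0 < (N k)%:R :> R by rewrite ltr0n; exact: leq_ltn_trans n0N.
have := small _ n0N; rewrite totalE; apply/negP; rewrite -leNgt.
have mb : 2 * delta <= mean_upto (w (stair n0)) (N k) by near: k; exact: bad_mean.
have : `|\sum_(1 <= j < (N k).+1) (w (stair j) j - w (stair n0) j)| <= (C + C) *+ n0.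
  apply: (@le_trans _ _ (\sum_(1 <= j < (N k).+1) if (j < n0.+1)%N then C + C else 0)).
    apply: le_trans (ler_norm_sum _ _ _) _; apply: ler_sum => j _.
    case: ltnP => h; last by rewrite stuck// subrr normr0.
    by apply: le_trans (ler_normB _ _) _; rewrite lerD.
  rewrite (@big_cat_nat _ _ _ n0.+1)//=; last by rewrite ltnS ltnW.
  rewrite (eq_big_nat _ _ (F2 := fun=> C + C)); last by move=> j /andP[_ ->].
  rewrite sumr_const_nat subn1/= [X in _ + X]big_nat big1 ?addr0// => j /andP[h _].
  by rewrite ltnNge h.
rewrite sumrB ler_norml => /andP[h _].
have : (C + C) *+ n0 <= delta * (N k)%:R.
  rewrite mulrC -ler_pdivrMr//; near: k.
  by have := cvg_comp N (fun n => n%:R : R) N_cvg (@cvgr_idn R) => /cvgryPge; apply.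
by move: mb; rewrite /mean_upto ler_pdivlMl// => mb h'; lra.
Unshelve. all: by end_near. Qed.

(** A bad length is only left at a time when the average is at least [delta]. *)
Lemma stair_often m : exists2 n, (m < n)%N & delta <= mean_upto (fun j => w (stair j) j) n.
Proof.
have [H mH badH] := bad_often (stair m).+1.
have := stair_unbounded H.+1 => exH.
case: (ex_minnP exH) => -[|n];
  first by rewrite /stair /= ltnS => H0; move: mH; rewrite leqNgt ltnS (leq_trans H0).
move=> Hn1 minn.
have Hn : (stair n <= H)%N by rewrite -ltnS ltnNge; apply/negP => /minn; rewrite ltnn.
have := stairS n; case: ifPn => [/asboolP trig|_] nE; last by move: Hn1; rewrite nE ltnNge Hn.
have {}Hn : stair n = H by apply/eqP; rewrite eqn_leq Hn -ltnS -nE.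
have mn : (m < n)%N.
  by rewrite ltnNge; apply/negP => /stair_mono; rewrite Hn leqNgt mH.
exists n => //; case: trig => [|]; first by rewrite Hn.
rewrite totalE mulrC => h.
by rewrite /mean_upto ler_pdivlMl ?ltr0n//; exact: leq_ltn_trans mn.
Qed.

End staircase.

(** * Orthogonality implies small short averages *)

Lemma cabs_mean_upto_le (R : realType) (c : nat -> R[i]) (M : R) N : 0 <= M ->
  (forall n, (0 < n)%N -> cabs (c n) <= M) -> cabs (mean_upto c N) <= M.
Proof.
move=> M0 cM; rewrite -ler_cabs; apply: mean_upto_bound; first by rewrite lecR.
by move=> n /andP[n0 _]; rewrite ler_cabs cM.
Qed.

Lemma cabs_mean_upto_shift (R : realType) (c : nat -> R[i]) (M : R) N h :
  (forall n, (0 < n)%N -> cabs (c n) <= M) ->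
  cabs (mean_upto (fun n => c (n + h)%N) N - mean_upto c N) <= N%:R^-1 * (M + M) *+ h.
Proof.
move=> cM; rewrite -ler_cabs.
apply: (le_trans (mean_upto_shift_bound (M := M%:C) _ _ _)).
  by move=> n n0; rewrite ler_cabs cM.
by rewrite rmorphMn rmorphM rmorphD fmorphV rmorph_nat.
Qed.

Lemma cabs_mean_uptoS (R : realType) (c : nat -> R[i]) (M : R) N :
  (forall n, (0 < n)%N -> cabs (c n) <= M) ->
  cabs (mean_upto c N.+1 - mean_upto c N) <= N.+1%:R^-1 * (M + M).
Proof.
move=> cM; have M0 : 0 <= M by apply: le_trans (cabs_ge0 _) (cM 1%N _).
(* True also for [N = 0], where [mean_upto c 0] is [0]. *)
have -> : mean_upto c N.+1 - mean_upto c N = (N.+1%:R^-1 : R)%:C * (c N.+1 - mean_upto c N).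
  rewrite fmorphV rmorph_nat /mean_upto big_nat_recr//=.
  case: N => [|N]; first by rewrite big_geq// invr0 !(mul0r, mulr0, subr0, add0r).
  by field; rewrite nat1r -natrD !pnatr_eq0.
rewrite cabsM cabs_real ger0_norm ?invr_ge0// ler_wpM2l ?invr_ge0//.
apply: le_trans (cabsB _ _) _; apply: lerD; first exact: cM.
exact: cabs_mean_upto_le.
Qed.

Section averages.
Context {R : realType} (L : R) (v : int -> R[i]).
Hypothesis vL : forall m, cabs (v m) <= L.

Definition forward (H : nat) (m : int) : R[i] := mean_upto (fun h => v (m + h%:Z)) H.

(** A Fejer-type mean of the conjugate of [v] around [m]: its correlation with
    [v] is, up to boundary terms, the quadratic mean of the averages [forward]. *)
Definition two_sided (H : nat) (m : int) : R[i] :=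
  mean_upto (fun h => (forward H (m - h%:Z))^*) H.

Let L0 : 0 <= L.
Proof. exact: le_trans (cabs_ge0 _) (vL 0). Qed.

Lemma forward_le H m : cabs (forward H m) <= L.
Proof. exact: cabs_mean_upto_le. Qed.

Lemma two_sided_le H m : cabs (two_sided H m) <= L.
Proof. by apply: cabs_mean_upto_le => // n _; rewrite cabs_conj forward_le. Qed.

Lemma two_sided_next H m :
  cabs (two_sided H (m + 1) - two_sided H m) <= H%:R^-1 * (L + L).
Proof.
rewrite /two_sided cabs_distC.
have := @cabs_mean_upto_shift R (fun h => (forward H (m + 1 - h%:Z))^*) L H 1.
rewrite mulr1n => h; rewrite (le_trans _ (h _))// => [|n _]; last first.
  by rewrite cabs_conj forward_le.
rewrite le_eqVlt; apply/orP; left; apply/eqP; congr (cabs (_ - _)).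
apply: eq_mean_upto => n _; congr ((forward H _)^*).
lia.
Qed.

(** The two averages involved are lengthened one after the other. *)
Lemma two_sided_longer H m :
  cabs (two_sided H.+1 m - two_sided H m) <= 2 * (H.+1%:R^-1 * (L + L)).
Proof.
rewrite -(subrKA (mean_upto (fun h => (forward H.+1 (m - h%:Z))^*) H)).
rewrite mulr_natl mulr2n; apply: le_trans (cabsD _ _) _; apply: lerD.
  by apply: cabs_mean_uptoS => n _; rewrite cabs_conj forward_le.
rewrite /two_sided mean_uptoB; apply: cabs_mean_upto_le => [|n _].
  by rewrite mulr_ge0 ?invr_ge0 ?addr_ge0.
by rewrite -raddfB cabs_conj; exact: cabs_mean_uptoS.
Qed.

(** Shifting by [h] the summation over [n], for each [h] of the outer average,
    turns the product into [(forward H n)^* * v (n + h)], and averaging over [h]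
    reconstitutes [forward H n]. *)
Lemma two_sided_correlation H N :
  cabs (mean_upto (fun n => two_sided H n%:Z * v n%:Z) N -
     (mean_upto (fun n => cabs (forward H n%:Z) ^+ 2) N)%:C) <=
  N%:R^-1 * (L * L + L * L) *+ H.
Proof.
pose g h (n : nat) := (forward H (n%:Z - h%:Z))^* * v n%:Z.
have gL h n : (0 < n)%N -> cabs (g h n) <= L * L.
  by rewrite /g cabsM cabs_conj ler_pM ?cabs_ge0 ?forward_le.
have -> : mean_upto (fun n => two_sided H n%:Z * v n%:Z) N =
    mean_upto (fun h => mean_upto (g h) N) H.
  rewrite -mean_upto_exchange; apply: eq_mean_upto => n _.
  by rewrite /two_sided /mean_upto -mulr_suml mulrA.
have -> : (mean_upto (fun n => cabs (forward H n%:Z) ^+ 2) N)%:C =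
    mean_upto (fun h => mean_upto (fun n => g h (n + h)%N) N) H.
  rewrite -mean_upto_exchange /mean_upto rmorphM fmorphV rmorph_nat rmorph_sum.
  congr (_ * _); apply: eq_bigr => n _.
  rewrite rmorphXn /= -norm_cabsE sqr_normc mulrC.
  rewrite {2}/forward {1}/mean_upto mulrCA mulr_sumr; congr (_ * _).
  by apply: eq_bigr => h _; rewrite /g PoszD addrK.
rewrite cabs_distC mean_uptoB; apply: le_trans (cabs_mean_upto _ _) _.
case: H g gL => [|H] g gL; first by rewrite /mean_upto big_geq// mulr0.
rewrite -[leRHS](@mean_upto_cst _ _ H.+1)//; apply: ler_mean_upto => h /andP[_ hH].
apply: le_trans (cabs_mean_upto_shift N h (gL h)) _.
by apply: ler_wpMn2l => //; rewrite mulr_ge0 ?invr_ge0// addr_ge0// mulr_ge0.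
Qed.

End averages.

Lemma Re_mean_upto (R : realType) (c : nat -> R[i]) N :
  complex.Re (mean_upto c N) = mean_upto (fun n => complex.Re (c n)) N.
Proof.
rewrite /mean_upto -raddf_sum (_ : N%:R^-1 = (N%:R^-1 : R)%:C); last first.
  by rewrite fmorphV rmorph_nat.
by case: (\sum_(_ <= _ < _) _) => x y /=; rewrite mul0r subr0.
Qed.

Lemma continuous_mean_upto (R : realType) (T : topologicalType) (f : nat -> T -> R[i]) N :
  (forall n, continuous (f n)) -> continuous (fun x => mean_upto (f ^~ x) N).
Proof.
move=> cf x; rewrite /mean_upto; apply: cvgM; first exact: cvg_cst.
by apply: cvg_big => [|n _]; [exact: add_continuous|exact: cf].
Qed.

Section necessity.
Context {R : realType} (L : {nonneg R}) (u : nat -> R[i]) (u0 : R[i]).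
Hypotheses (uL : forall n : nat, (0 < n)%N -> `|u n| <= (L%:num)%:C)
  (u0L : `|u0| <= (L%:num)%:C).

Let v := extension_value u u0.

Let vL m : cabs (v m) <= L%:num.
Proof. by rewrite -ler_cabs; exact: extension_subproof. Qed.

Let vE (n : nat) : (0 < n)%N -> v n%:Z = u n.
Proof. by case: n. Qed.

Lemma forward_extension H n :
  forward v H n%:Z = mean_upto (fun h => u (n + h)%N) H.
Proof.
by apply: eq_mean_upto => h /andP[h0 _]; rewrite -PoszD vE// addn_gt0 h0 orbT.
Qed.

(** The summand is a continuous function on the shift space evaluated along the
    orbit of the extension of [u]. *)
Lemma short_average_limit N H : defines_furstenberg_system (extension uL u0L) N ->
  exists l : R, mean_upto (fun n => cabs (mean_upto (fun h => u (n + h)%N) H) ^+ 2) (N k)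
    @[k --> \oo] --> l.
Proof.
move=> [_ [nu nuE]].
have [g cg gs] := @shift_space_cantor R L.
have cS := cantor_image_compact cg gs.
pose f (z : shift_space L) : R := cabs (mean_upto (fun h => disc_val (z h%:Z)) H) ^+ 2.
have cf : continuous f.
  have cm : continuous (fun z : shift_space L => mean_upto (fun h => disc_val (z h%:Z)) H).
    by apply: continuous_mean_upto => h; exact: shift_space_eval_continuous.
  have cc : continuous (fun z : shift_space L => cabs (mean_upto (fun h => disc_val (z h%:Z)) H)).
    move=> z; apply: (@continuous_comp _ _ _
      (fun z : shift_space L => mean_upto (fun h => disc_val (z h%:Z)) H) cabs).
      exact: cm.
    exact: cabs_continuous.
  move=> z; apply: (@continuous_comp _ _ _
    (fun z : shift_space L => cabs (mean_upto (fun h => disc_val (z h%:Z)) H)) (fun x : R => x ^+ 2)).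
    exact: cc.
  exact: exprn_continuous.
exists (\int[nu]_z f z)%R.
have := weak_star_mean cS nuE cf.
rewrite (_ : (fun k => _) = fun k =>
  mean_upto (fun n => cabs (mean_upto (fun h => u (n + h)%N) H) ^+ 2) (N k))//.
apply/funext => k; apply: eq_mean_upto => n /andP[n0 _].
rewrite /f; congr (cabs _ ^+ 2); apply: eq_mean_upto => h /andP[h0 _].
rewrite iter_left_shift -PoszD addnC; exact: vE (ltn_addr _ n0).
Qed.

(** Otherwise there are bad lengths [H], for which the quadratic mean exceeds
    [eps], beyond any bound. The two-sided averages with slowly growing window
    length form a slowly varying sequence whose correlation with [u] is
    infinitely often at least [eps / 4]. *)
Lemma orthogonal_short_averages :
  orthogonal_class_ID u ->
  forall eps : R, 0 < eps ->
   forall N : nat -> nat, defines_furstenberg_system (extension uL u0L) N ->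
   exists H0 : nat, (1 <= H0)%N /\
     forall H : nat, (H0 <= H)%N ->
     exists2 l : R,
       mean_upto (fun n : nat =>
         complex.Re `|mean_upto (fun h : nat => u (n + h)%N) H| ^+ 2) (N k)
         @[k --> \oo] --> l
       & l <= eps.
Proof.
move=> orth eps eps0 N furst.
have /choice[l lP] := fun H => short_average_limit H furst.
have [[_ Ninc] _] := furst; have Noo := increasing_cvg Ninc.
apply: contrapT => nH0.
pose bad H := eps < l H.
have bad_often m : exists2 H, (m <= H)%N & bad H.
  apply: contrapT => nbad; apply: nH0; exists m.+1; split => // H mH.
  exists (l H); first exact: lP.
  by rewrite leNgt; apply/negP => h; apply: nbad; exists H => //; exact: ltnW.
pose w H (n : nat) := complex.Re (two_sided v H n%:Z * v n%:Z).
have L0 : 0 <= L%:num by [].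
have wC H n : `|w H n| <= L%:num * L%:num.
  apply: le_trans (cabs_Re _) _; rewrite cabsM ler_pM ?cabs_ge0//.
  exact: two_sided_le.
have d0 : 0 < eps / 4 by rewrite divr_gt0.
have bad_mean H : bad H -> \forall k \near \oo, 2 * (eps / 4) <= mean_upto (w H) (N k).
  move=> badH; near=> k.
  have h1 : eps <= mean_upto (fun n => cabs (forward v H n%:Z) ^+ 2) (N k).
    under eq_mean_upto do rewrite forward_extension.
    near: k; exact: (cvgr_ge _ (lP H) _ badH).
  have h2 : (N k)%:R^-1 * (L%:num * L%:num + L%:num * L%:num) *+ H <= eps / 2.
    near: k.
    have : (N k)%:R^-1 * (L%:num * L%:num + L%:num * L%:num) *+ H @[k --> \oo] --> (0 : R).
      rewrite -[X in _ --> X](mul0r ((L%:num * L%:num + L%:num * L%:num) *+ H)).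
      under eq_fun do rewrite -mulrnAr.
      by apply: cvgM; [exact: (cvg_comp N (fun n => n%:R^-1 : R) Noo (@cvg_invn R))|exact: cvg_cst].
    by move=> /cvgr_le; apply; rewrite divr_gt0.
  have := le_trans (cabs_Re _) (two_sided_correlation vL H (N k)).
  rewrite raddfB /= Re_mean_upto ler_norml => /andP[h3 _].
  rewrite -/(w H) in h3 *.
  lra.
have [Hn [HnS Hn_mono Hn_unbounded Hn_often]] : exists Hn : nat -> nat, [/\
    forall n, Hn n.+1 = Hn n \/ Hn n.+1 = (Hn n).+1,
    forall m n, (m <= n)%N -> (Hn m <= Hn n)%N,
    forall m, exists n, (m <= Hn n)%N
  & forall m, exists2 n, (m < n)%N & eps / 4 <= mean_upto (fun j => w (Hn j) j) n].
  exists (stair w bad (eps / 4)); split => [n|m n|m|m].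
  - exact: stair_step.
  - exact: stair_mono.
  - exact: (stair_unbounded d0 wC Noo bad_mean).
  - exact: (stair_often d0 wC Noo bad_often bad_mean).
pose aval (m : int) : R[i] :=
  if m is Posz n then two_sided v (Hn n) n%:Z else two_sided v (Hn 0%N) 0.
have aL m : `|aval m| <= (L%:num)%:C.
  by rewrite ler_cabs; case: m => n; exact: two_sided_le.
pose a m : closed_disc L := to_closed_disc (aL m).
have aP (n : nat) : disc_val (a n%:Z) = two_sided v (Hn n) n%:Z by [].
have slow e : 0 < e -> exists K, forall n : int, (K <= `|n|)%N ->
    cabs (disc_val (a (n + 1)) - disc_val (a n)) < e.
  (* A step of [n] costs [2 * L / H], a step of [H] costs [4 * L / (H + 1)]. *)
  move=> e0; pose c := 6 * L%:num.
  have [K0 _ K0e] : \forall n \near \oo, n%:R^-1 * c < e.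
    have : (n%:R^-1 : R) * c @[n --> \oo] --> 0 * c.
      by apply: cvgM; [exact: cvg_invn|exact: cvg_cst].
    by move=> /cvgr_lt; apply; rewrite mul0r.
  have [K HK] := Hn_unbounded K0.+1.
  (* For negative indices the sequence is constant. *)
  exists K => -[n|[|n]] /= Kn.
  - rewrite (_ : Posz n + 1 = n.+1%:Z); last by rewrite intS addrC.
    apply: (@le_lt_trans _ _ ((Hn n)%:R^-1 * c)); last first.
      apply: K0e => /=; apply: leq_trans (ltnW HK) _; exact: Hn_mono.
    have Hn0 : (0 < Hn n)%N by apply: leq_ltn_trans (leq0n K0) (leq_trans HK (Hn_mono _ _ Kn)).
    have := two_sided_next vL (Hn n) n%:Z; have := two_sided_longer vL (Hn n) n.+1%:Z.
    rewrite (_ : n%:Z + 1 = n.+1%:Z); last by rewrite intS addrC.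
    rewrite !aP.
    have inv_le : (Hn n).+1%:R^-1 <= (Hn n)%:R^-1 :> R.
      by rewrite lef_pV2 ?posrE ?ltr0n// ler_nat.
    have : (Hn n).+1%:R^-1 * (L%:num + L%:num) <= (Hn n)%:R^-1 * (L%:num + L%:num).
      by rewrite ler_wpM2r// addr_ge0.
    have i0 : 0 <= (Hn n)%:R^-1 * (L%:num + L%:num) by rewrite mulr_ge0 ?invr_ge0 ?addr_ge0.
    have -> : (Hn n)%:R^-1 * c = 3 * ((Hn n)%:R^-1 * (L%:num + L%:num)) by rewrite /c; ring.
    move: ((Hn n)%:R^-1 * (L%:num + L%:num)) ((Hn n).+1%:R^-1 * (L%:num + L%:num)) i0.
    move=> x y x0 yx h1 h2.
    case: (HnS n) => ->; first by lra.
    rewrite -(subrKA (two_sided v (Hn n) n.+1%:Z)).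
    by apply: le_trans (cabsD _ _) _; lra.
  - by rewrite /disc_val /= subrr cabs0.
  - by rewrite (_ : Negz n.+1 + 1 = Negz n) ?subrr ?cabs0//; lia.
have := orth (slow_space a) _ (slow_space_class_ID slow) _ (inl 0) (fiber_continuous (a := a)).
rewrite (_ : (fun n => _) = fun n => mean_upto (fun j => two_sided v (Hn j) j%:Z * v j%:Z) n); last first.
  apply/funext => n; apply: eq_mean_upto => j /andP[j0 _].
  by rewrite iter_translate add0r vE.
move=> /cvg_cabsP/(_ _ d0)[K _ hK].
(* The limit [0] contradicts the correlations of size [eps / 4]. *)
have [n Kn] := Hn_often K.
apply/negP; rewrite -ltNge; have := hK n (ltnW Kn); rewrite sub0r cabsN.
apply: le_lt_trans; apply: le_trans (cabs_Re _).
by rewrite Re_mean_upto ler_norm.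
Unshelve. all: by end_near. Qed.

End necessity.

Unset Implicit Arguments.

Theorem corollary1p8 (R : realType) (L : {nonneg R})
    (u : nat -> R[i]) (u0 : R[i])
    (uL : forall n : nat, (0 < n)%N -> `|u n| <= (L%:num)%:C)
    (u0L : `|u0| <= (L%:num)%:C) :
  orthogonal_class_ID u <->
  (forall eps : R, 0 < eps ->
   forall N : nat -> nat, defines_furstenberg_system (extension uL u0L) N ->
   exists H0 : nat, (1 <= H0)%N /\
     forall H : nat, (H0 <= H)%N ->
     exists2 l : R,
       mean_upto (fun n : nat =>
         complex.Re `|mean_upto (fun h : nat => u (n + h)%N) H| ^+ 2) (N k)
         @[k --> \oo] --> l
       & l <= eps).
Proof.
split; first exact: orthogonal_short_averages.
exact: short_averages_orthogonal.
Qed.
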